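(* Let $d,m,p$ be positive integers and let $\mathbf{M}:\mathbb{Z}^d\to\mathbb{R}^{m\times p}$ satisfy $\sum_{\boldsymbol{\sigma}\in\mathbb{Z}^d}\|\mathbf{M}(\boldsymbol{\sigma})\|<\infty$. Let $\mathbf{e}=\{\mathbf{e}(\mathbf{t}),\,\mathbf{t}\in\mathbb{Z}^d\}$ be normalized $p$-dimensional white Gaussian noise and let $$\mathbf{y}(\mathbf{t})=\sum_{\boldsymbol{\sigma}\in\mathbb{Z}^d}\mathbf{M}(\boldsymbol{\sigma})\,\mathbf{e}(\mathbf{t}-\boldsymbol{\sigma}),\qquad \mathbf{t}\in\mathbb{Z}^d.$$ Let $\mathbf{R}_{\mathbf{k}}:=\mathbb{E}\,\mathbf{y}(\mathbf{t}+\mathbf{k})\mathbf{y}(\mathbf{t})^{\top}$ (independent of $\mathbf{t}$) and $\mathbf{\Phi}(e^{i\boldsymbol{\theta}}):=\sum_{\mathbf{k}\in\mathbb{Z}^d}\mathbf{R}_{\mathbf{k}}e^{-i\langle\mathbf{k},\boldsymbol{\theta}\rangle}$ for $\boldsymbol{\theta}\in\mathbb{T}^d:=[0,2\pi)^d$. Let $f:\mathbb{N}\to\mathbb{N}$ satisfy $\lim_{N\to\infty}f(N)=\infty$ and $\lim_{N\to\infty}f(N)^2/N=0$. For each $N$ set $n:=f(N)$, let $\Lambda_n:=\{\mathbf{k}\in\mathbb{Z}^d:|k_j|\le n\text{ for }j=1,\dots,d\}$, and define, from the observations $\{\mathbf{y}(\mathbf{t}):1\le t_j\le N,\ j=1,\dots,d\}$,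 the $f$-truncated periodogram built with the biased covariance estimates $$\hat{\mathbf{\Phi}}(e^{i\boldsymbol{\theta}}):=\sum_{\mathbf{k}\in\Lambda_n}\hat{\mathbf{R}}_{\mathbf{k}}e^{-i\langle\mathbf{k},\boldsymbol{\theta}\rangle},\qquad \hat{\mathbf{R}}_{\mathbf{k}}:=\frac{1}{N^d}\sum_{\mathbf{t}\in\Xi_{N,\mathbf{k}}}\mathbf{y}(\mathbf{t}+\mathbf{k})\mathbf{y}(\mathbf{t})^{\top}.$$ Then $\hat{\mathbf{\Phi}}$ is a uniformly mean-square consistent estimator of the spectral density, that is, with $\mathbf{\Delta}(e^{i\boldsymbol{\theta}}):=\mathbf{\Phi}(e^{i\boldsymbol{\theta}})-\hat{\mathbf{\Phi}}(e^{i\boldsymbol{\theta}})$, $$\lim_{N\to\infty}\mathbb{E}\,\|\mathbf{\Delta}(e^{i\boldsymbol{\theta}})\|^2=0\qquad\text{uniformly over }\boldsymbol{\theta}\in\mathbb{T}^d.$$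
   Context: $\|\cdot\|$ denotes the Frobenius norm of a matrix and $\langle\mathbf{k},\boldsymbol{\theta}\rangle:=k_1\theta_1+\dots+k_d\theta_d$. ''Normalized $p$-dimensional white Gaussian noise'' means that the $\mathbf{e}(\mathbf{t})$, $\mathbf{t}\in\mathbb{Z}^d$, are independent real Gaussian random vectors in $\mathbb{R}^p$ with zero mean and identity covariance matrix; the series defining $\mathbf{y}(\mathbf{t})$ converges in mean square. For $\mathbf{k}\in\mathbb{Z}^d$ with $|k_j|<N$ for all $j$, $\Xi_{N,\mathbf{k}}$ is the set of $\mathbf{t}\in\mathbb{Z}^d$ such that, for each $j=1,\dots,d$: $1\le t_j\le N-k_j$ if $k_j\ge0$, and $-k_j+1\le t_j\le N$ if $k_j<0$. The hypothesis $f(N)^2/N\to0$ ensures $n=f(N)<N$ for all sufficiently large $N$, and only such $N$ matter for the limit. *)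

(* Defs.v *)
From HB Require Import structures.
From mathcomp Require Import all_boot all_order all_algebra.
From mathcomp Require Import finmap complex.
From mathcomp Require Import all_classical all_reals all_analysis.
From mathcomp Require summability.

Set Implicit Arguments.
Unset Strict Implicit.
Unset Printing Implicit Defensive.
Import Order.TTheory GRing.Theory Num.Theory.
Import numFieldNormedType.Exports.

Local Open Scope classical_set_scope.
Local Open Scope ring_scope.
Local Open Scope complex_scope.

(* Multi-indices in Z^d are row vectors 'rV[int]_d; random fields indexed by
   Z^d are functions 'rV[int]_d -> T -> 'cV[R]_q on a sample space T. *)

Definition frobenius (R : realType) (m n : nat) (A : 'M[R]_(m, n)) : R :=
  Num.sqrt (\sum_i \sum_j A i j ^+ 2).

Definition cfrobenius (R : realType) (m n : nat) (A : 'M[R[i]]_(m, n)) : R :=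
  Num.sqrt (\sum_i \sum_j Normc.normc (A i j) ^+ 2).

Definition cexpi (R : realType) (x : R) : R[i] := cos x +i* sin x.

Definition pairing (R : realType) (d : nat) (k : 'rV[int]_d) (theta : 'rV[R]_d)
  : R := \sum_j (k ord0 j)%:~R * theta ord0 j.

Definition torus (R : realType) (d : nat) : set 'rV[R]_d :=
  [set theta | forall j, 0 <= theta ord0 j < 2 * pi].

Section Noise.
Context (disp : measure_display) (T : measurableType disp) (R : realType).
Variable P : probability T R.

Definition random_vector (q : nat) (X : T -> 'cV[R]_q) : Prop :=
  forall i, measurable_fun setT (fun w => X w i ord0).

(* The library's [normal_prob mu 0] is the uniform law on [0, 1], so the
   degenerate Gaussian law has to be given separately. *)
Definition gaussian_law (mu sigma : R) (A : set R) : \bar R :=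
  if sigma == 0 then dirac mu A else normal_prob mu sigma A.

Definition gaussian_vector (q : nat) (X : T -> 'cV[R]_q) : Prop :=
  random_vector X /\
  forall a : 'cV[R]_q, exists mu sigma : R, forall A : set R, measurable A ->
    P ((fun w => (a^T *m X w) ord0 ord0) @^-1` A) = gaussian_law mu sigma A.

(* [g_sigma_preimage] applied to the coordinates of X is the sigma-algebra
   generated by X. *)
Definition sigma_vector (q : nat) (X : T -> 'cV[R]_q) : set (set T) :=
  g_sigma_preimage (fun (i : 'I_q) w => X w i ord0).

Definition independent_vectors (I : choiceType) (q : nat)
    (X : I -> T -> 'cV[R]_q) : Prop :=
  forall (F : {fset I}) (A : I -> set T),
    (forall t, t \in F -> sigma_vector (X t) (A t)) ->
    P (\bigcap_(t in [set` F]) A t) = (\prod_(t <- F) P (A t))%E.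

Definition white_gaussian_noise (d p : nat)
    (e : 'rV[int]_d -> T -> 'cV[R]_p) : Prop :=
  [/\ forall t, gaussian_vector (e t),
      forall t i, ('E_P[fun w => e t w i ord0] = 0)%E,
      forall t i j,
        covariance P (fun w => e t w i ord0) (fun w => e t w j ord0)
        = ((i == j)%:R)%:E
    & independent_vectors e].

(* y t is the mean-square limit of the finite partial sums over Z^d, along the
   directed set of finite subsets of Z^d; y t is thereby determined up to
   almost sure equality. *)
Definition filtered_noise (d m p : nat) (M : 'rV[int]_d -> 'M[R]_(m, p))
    (e : 'rV[int]_d -> T -> 'cV[R]_p) (y : 'rV[int]_d -> T -> 'cV[R]_m)
    : Prop :=
  forall t, random_vector (y t) /\
    (fun F : {fset 'rV[int]_d} =>
       ('E_P[fun w => (frobenius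
              (y t w - \sum_(s <- F) M s *m e (t - s) w) ^+ 2)%R])%E)
      @ summability.totally --> 0%E.

End Noise.

Section Spectral.
Context (disp : measure_display) (T : measurableType disp) (R : realType).
Variables (P : probability T R) (d m : nat).
Variable y : 'rV[int]_d -> T -> 'cV[R]_m.

Definition lag_product (t k : 'rV[int]_d) (w : T) : 'M[R]_m :=
  y (t + k) w *m (y t w)^T.

Definition lag_cov (t k : 'rV[int]_d) : 'M[R]_m :=
  \matrix_(i, j) fine ('E_P[fun w => lag_product t k w i j])%E.

(* The reference point t is immaterial for the fields considered here. *)
Definition autocov (k : 'rV[int]_d) : 'M[R]_m := lag_cov 0 k.

Definition fourier_term (C : 'M[R]_m) (k : 'rV[int]_d) (theta : 'rV[R]_d)
  : 'M[R[i]]_m := cexpi (- pairing k theta) *: map_mx (real_complex R) C.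

(* Unconditional sum over Z^d of a family of complex matrices. *)
Definition spectral_density (theta : 'rV[R]_d) : 'M[R[i]]_m :=
  summability.sum (fun k : 'rV[int]_d => fourier_term (autocov k) k theta).

Definition Lambda (n : nat) : set 'rV[int]_d :=
  [set k | forall j, `|k ord0 j| <= n%:Z].

Definition Xi (N : nat) (k : 'rV[int]_d) : set 'rV[int]_d :=
  [set t | forall j, if 0 <= k ord0 j
                     then 1 <= t ord0 j <= N%:Z - k ord0 j
                     else - k ord0 j + 1 <= t ord0 j <= N%:Z].

Definition biased_cov (N : nat) (k : 'rV[int]_d) (w : T) : 'M[R]_m :=
  (N%:R ^+ d)^-1 *: \sum_(t \in Xi N k) lag_product t k w.

Definition truncated_periodogram (n N : nat) (theta : 'rV[R]_d) (w : T)
    : 'M[R[i]]_m :=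
  \sum_(k \in Lambda n) fourier_term (biased_cov N k w) k theta.

End Spectral.

(* Main.v *)
Require Import Defs.
From HB Require Import structures.
From mathcomp Require Import all_boot all_order all_algebra.
From mathcomp Require Import finmap complex.
From mathcomp Require Import all_classical all_reals all_analysis.
From mathcomp Require Import measurable_realfun.
From mathcomp Require Import ring lra zify.
Set Implicit Arguments.
Unset Strict Implicit.
Unset Printing Implicit Defensive.
Import Order.TTheory GRing.Theory Num.Theory.
Import numFieldNormedType.Exports.
Local Open Scope classical_set_scope.
Local Open Scope ring_scope.

(** With x_t := y(t+k)_i y(t)_j, the estimate of an entry of R_k is the average of the x_t
    over Xi up to the factor |Xi| / N^d.  Replacing y by the finite sums that define it,
    a sum of the x_t becomes a linear combination, with coefficients whose absolute values
    have a bounded sum, of sums over t of products of two noise coordinates at fixed offsets.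
    For fixed offsets such products are uncorrelated unless the two times coincide
    or differ by plus or minus the difference of the offsets, so each of these sums has
    variance O(|Xi|) by independence and the finiteness of the fourth moments; by weighted
    Cauchy-Schwarz the variance of the estimate of R_k is O(N^-d) uniformly in k.
    Cauchy-Schwarz over the (2n+1)^d lags then bounds the fluctuation of the periodogram
    by a constant times ((2n+1)^2 / N)^d, which tends to 0.  The bias tends to 0 because
    the R_k are absolutely summable and |Xi| / N^d tends to 1 for each fixed k. *)

(** * Independence and products *)

(** The field [y] is known only as a mean-square limit, so products of its coordinates are
    approximated in L1. Every estimate is therefore proved for finite sums, with constants that see
    the coefficients through their l1 norm alone; covariance identities then pass to the limit in
    L1, and second-moment bounds pass by a truncation argument. Independence is given on events of
    the generated sigma-algebras and has to be upgraded to expectations of products of unbounded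
    factors. Gaussianity enters through a fourth-moment bound for the noise: its law comes with
    unspecified parameters, and the bound is extracted from the unit second moment without
    identifying them. Uniformity in the frequency comes from the exponentials having modulus one:
    every bound is put on the covariances, where the frequency no longer occurs. *)

Section Density.
Import HBNNSimple.

(** Serves twice: with [V] a random variable and [W] the product of the remaining independent
    factors, and with [V] the identity and [W] a Gaussian density. Simple functions reduce the claim
    to the hypothesis on sets; monotone convergence passes to the limit on both sides. *)
Lemma ge0_integral_density d d' (S : measurableType d) (Y : measurableType d')
    (R : realType) (m : {measure set S -> \bar R})
    (nu : {measure set Y -> \bar R}) (V : S -> Y) (W : S -> R) :
  measurable_fun setT V -> measurable_fun setT W -> (forall x, 0 <= W x) ->
  (forall B, measurable B ->
     nu B = \int[m]_x (\1_B (V x) * W x)%:E)%E ->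
  forall phi : Y -> R, measurable_fun setT phi -> (forall y, 0 <= phi y) ->
  (\int[nu]_y (phi y)%:E = \int[m]_x (phi (V x) * W x)%:E)%E.
Proof.
move=> mV mW W0 nuE phi mphi phi0.
have mphi' := (measurable_EFinP setT phi).2 mphi.
pose f := nnsfun_approx measurableT mphi'.
have f_cvg y : EFin \o f^~ y @ \oo --> (phi y)%:E.
  by apply: (cvg_nnsfun_approx measurableT mphi') => // z _; rewrite lee_fin.
have f_nd : nondecreasing_seq (f : (Y -> R)^nat) by exact: nd_nnsfun_approx.
have mfV n : measurable_fun setT (fun x => f n (V x) * W x).
  by apply: measurable_funM => //; exact: measurableT_comp.
transitivity (limn (fun n => \int[nu]_y (f n y)%:E)%E).
  rewrite -monotone_convergence//.
  - by apply: eq_integral => y _; apply/esym/cvg_lim => //; exact: f_cvg.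
  - by move=> n; exact/measurable_EFinP/measurable_funP.
  - by move=> n y _; rewrite lee_fin.
  - by move=> y _ a b ab; rewrite lee_fin; exact/lefP/f_nd.
rewrite [X in limn X](_ : _ = fun n => \int[m]_x (f n (V x) * W x)%:E)%E;
    last first.
  apply/funext => n.
  transitivity (\sum_(r \in range (f n))
      \int[m]_x (r * (\1_(f n @^-1` [set r]) (V x) * W x))%:E)%E.
    under eq_integral do rewrite fimfunE -fsumEFin//.
    rewrite ge0_integral_fsum//; last 2 first.
    - by move=> y; exact/measurable_EFinP/measurable_funM.
    - by move=> y x _; rewrite nnfun_muleindic_ge0.
    apply: eq_fsbigr => r rf; rewrite integralZl_indic_nnsfun// integral_indic//=.
    rewrite setIT nuE//; under [in RHS]eq_integral do rewrite EFinM.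
    rewrite ge0_integralZl_EFin//.
    - by move=> x _; rewrite lee_fin mulr_ge0.
    - apply/measurable_EFinP/measurable_funM => //.
      by apply: measurableT_comp => //; exact: measurable_indic.
    - by move: rf; rewrite inE => -[y _ <-].
  rewrite -ge0_integral_fsum//.
  - apply: eq_integral => x _; rewrite fsumEFin//; congr EFin.
    rewrite [X in _ = X * _]fimfunE mulr_fsuml.
    by apply: eq_fsbigr => r _; rewrite mulrA.
  - move=> r; apply/measurable_EFinP/measurable_funM => //.
    apply: measurable_funM => //.
    by apply: measurableT_comp => //; exact: measurable_indic.
  - move=> r x _; rewrite lee_fin mulrA mulr_ge0//.
    by have := nnfun_muleindic_ge0 (f n) r (V x); rewrite -EFinM lee_fin.
rewrite -monotone_convergence//.
- apply: eq_integral => x _; apply/cvg_lim => //.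
  apply/fine_cvgP; split; first by near=> n.
  rewrite /comp/=; apply: (@cvgM R); last exact: cvg_cst.
  exact: (fine_cvg (f_cvg (V x))).
- by move=> n; exact/measurable_EFinP.
- by move=> n x _; rewrite lee_fin mulr_ge0.
- move=> x _ a b ab; rewrite lee_fin ler_wpM2r//; exact/lefP/f_nd.
Unshelve. all: by end_near.
Qed.

End Density.

Section Independence.
Context (disp : measure_display) (T : measurableType disp) (R : realType).
Variable P : probability T R.

(** By hypothesis the measure with value [E(1_B(X) W)] at [B] is the law of [X] scaled by the
    constant [E W]; integrating [x] against it gives the product. *)
Lemma ge0_indep_integralM (X W : T -> R) :
    measurable_fun setT X -> measurable_fun setT W ->
    (forall w, 0 <= X w) -> (forall w, 0 <= W w) ->
    (\int[P]_w (W w)%:E < +oo)%E ->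
    (forall B, measurable B -> \int[P]_w (\1_B (X w) * W w)%:E
       = P (X @^-1` B) * \int[P]_w (W w)%:E)%E ->
  (\int[P]_w (X w * W w)%:E = \int[P]_w (X w)%:E * \int[P]_w (W w)%:E)%E.
Proof.
move=> mX mW X0 W0 Wfin XW.
have Wge0 : (0 <= \int[P]_w (W w)%:E)%E.
  by apply: integral_ge0 => w _; rewrite lee_fin.
have Wf : (\int[P]_w (W w)%:E)%E \is a fin_num by rewrite ge0_fin_numE.
pose c := NngNum (fine_ge0 Wge0).
pose X' : {RV P >-> R} := HB.pack X (isMeasurableFun.Build _ _ _ _ X mX).
pose nu := mscale c (distribution P X').
(* The absolute value replaces the identity, since the density lemma asks for a function that is
   nonnegative on the whole line. *)
have mid : measurable_fun setT (fun x : R => `|x|).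
  exact: measurableT_comp.
have nuE B : measurable B ->
    nu B = (\int[P]_w (\1_B (X w) * W w)%:E)%E.
  by move=> mB; rewrite XW// /nu /mscale/= /pushforward fineK// muleC.
have := ge0_integral_density mX mW W0 nuE mid (fun x => normr_ge0 x).
under [X in _ = X -> _]eq_integral do rewrite ger0_norm//.
move=> <-; rewrite ge0_integral_mscale//=; last first.
  by apply/measurable_EFinP.
rewrite ge0_integral_distribution//; last by apply/measurable_EFinP.
rewrite fineK// muleC; congr (_ * _)%E.
by apply: eq_integral => w _ /=; rewrite ger0_norm.
Qed.


Local Notation L1 X := (P.-integrable [set: T] (EFin \o X)).
Local Notation mean X := (Rintegral P [set: T] X).

Variables (I : choiceType) (G : I -> set (set T)).
Hypothesis G_measurable : forall t A, G t A -> measurable A.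
Hypothesis G_indep : forall (F : {fset I}) (A : I -> set T),
  (forall t, t \in F -> G t (A t)) ->
  P (\bigcap_(t in [set` F]) A t) = (\prod_(t <- F) P (A t))%E.

(** Measurability with respect to [G t], phrased by preimages because [G t] is a bare class of sets
    here. *)
Definition adapted (t : I) (X : T -> R) :=
  forall B, measurable B -> G t (X @^-1` B).

Lemma adapted_measurable t X : adapted t X -> measurable_fun setT X.
Proof. by move=> aX _ B mB; rewrite setTI; exact/(@G_measurable t)/aX. Qed.

Lemma adapted_comp t X (g : R -> R) :
  measurable_fun setT g -> adapted t X -> adapted t (g \o X).
Proof.
move=> mg aX B mB; rewrite comp_preimage; apply: aX.
by rewrite -[X in measurable X]setTI; exact: mg.
Qed.

Lemma indep_integral_prod_indic (r : seq I) (Z : I -> T -> R) :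
  uniq r -> (forall t, t \in r -> adapted t (Z t)) ->
  (forall t, t \in r -> exists A, Z t = \1_A) ->
  (\int[P]_w (\prod_(t <- r) Z t w)%:E
    = \prod_(t <- r) \int[P]_w (Z t w)%:E)%E.
Proof.
(* The event is recovered as the preimage of 1, which adaptedness places in [G t]; the set given by
   [Z1] comes without that information. *)
move=> ur aZ Z1; pose A t := Z t @^-1` [set 1].
have ZA t w : t \in r -> Z t w = \1_(A t) w.
  move=> /Z1[B ZB]; rewrite /A ZB !indicE; congr (_%:R); congr nat_of_bool.
  apply/idP/idP => h; rewrite !inE/= ?inE in h *.
    by rewrite indicE mem_set.
  move: h; rewrite indicE; case: (boolP (w \in B)); first by rewrite inE.
  by move=> _ /eqP; rewrite eq_sym oner_eq0.
have GA t : t \in r -> G t (A t) by move=> tr; apply: aZ.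
pose F := [fset t in r]%fset.
have perm_r : perm_eq r F.
  by apply: uniq_perm => //= t; rewrite !inE.
have mF : measurable (\bigcap_(t in [set` F]) A t).
  apply: fin_bigcap_measurable => [|t]; first exact: finite_fset.
  rewrite /= inE => tr.
  exact: G_measurable (GA t tr).
transitivity (P (\bigcap_(t in [set` F]) A t)).
  rewrite -[in RHS](setIT (\bigcap_(t in _) _)) -integral_indic//.
  apply: eq_integral => w _; congr EFin.
  rewrite big_seq (eq_bigr (fun t => (w \in A t)%:R)); last first.
    by move=> t /ZA ->; rewrite indicE.
  rewrite -big_seq indicE.
  have [h|h] := boolP (w \in \bigcap_(t in [set` F]) A t).
    rewrite big_seq big1// => t tr; rewrite mem_set//.
    by move: h; rewrite inE => /(_ t); apply => /=; rewrite inE.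
  have : exists2 t, t \in r & w \notin A t.
    apply: contrapT => h'; move/negP: h; apply; rewrite inE => t /=.
    rewrite inE => tr; apply: contrapT => wA; apply: h'; exists t => //.
    by apply/negP; rewrite inE.
  move=> [t tr wA]; rewrite (perm_big _ (perm_to_rem tr)) big_cons.
  by rewrite (negbTE wA); exact: mul0r.
rewrite G_indep => [|t]; last by rewrite !inE => /GA.
rewrite (perm_big _ perm_r)/= [LHS]big_seq [RHS]big_seq.
apply: eq_bigr => t; rewrite inE => tr.
under eq_integral do rewrite ZA//.
by rewrite integral_indic ?setIT//; exact: G_measurable (GA t tr).
Qed.

(** [r] holds the factors that are already indicators, [s] the general ones. Induction on [s]:
    replacing the head [Z t] by the indicator of an event [Z t \in B] moves it to [r], and the
    induction hypothesis becomes what [ge0_indep_integralM] requires. *)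
Lemma ge0_indep_integral_prod (s r : seq I) (Z : I -> T -> R) :
  uniq (s ++ r) -> (forall t, t \in s ++ r -> adapted t (Z t)) ->
  (forall t w, 0 <= Z t w) ->
  (forall t, t \in s ++ r -> \int[P]_w (Z t w)%:E < +oo)%E ->
  (forall t, t \in r -> exists A, Z t = \1_A) ->
  (\int[P]_w (\prod_(t <- s ++ r) Z t w)%:E
    = \prod_(t <- s ++ r) \int[P]_w (Z t w)%:E)%E.
Proof.
elim: s r Z => [|t s IH] r Z /=; first by move=> *; exact: indep_integral_prod_indic.
move=> /andP[tsr usr] aZ Z0 Zfin Z1.
have perm_t : perm_eq (s ++ t :: r) (t :: s ++ r).
  exact: permEl (perm_catCA s [:: t] r).
pose W w := \prod_(u <- s ++ r) Z u w.
have W0 w : 0 <= W w by apply: prodr_ge0.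
have mZ u : u \in t :: s ++ r -> measurable_fun setT (Z u).
  by move=> ur; apply: (adapted_measurable (t := u)); exact: aZ.
have mW : measurable_fun setT W.
  apply: measurable_prod => u us; apply: mZ; by rewrite inE us orbT.
have IH_indic B : measurable B ->
    (\int[P]_w (\1_B (Z t w) * W w)%:E
    = P (Z t @^-1` B) * \prod_(u <- s ++ r) \int[P]_w (Z u w)%:E)%E.
  move=> mB; have mtB : measurable (Z t @^-1` B).
    by apply: (@G_measurable t); apply: aZ => //; rewrite mem_head.
  pose Z' u w := if u == t then \1_B (Z t w) else Z u w.
  have Z'E u w : u \in s ++ r -> Z' u w = Z u w.
    by rewrite /Z'; case: eqP => // ->; rewrite (negbTE tsr).
  have IHZ : (\int[P]_w (\prod_(u <- s ++ t :: r) Z' u w)%:E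
      = \prod_(u <- s ++ t :: r) \int[P]_w (Z' u w)%:E)%E.
    apply: IH.
    - by rewrite (perm_uniq perm_t) /= tsr usr.
    - move=> u; rewrite (perm_mem perm_t) inE /Z' => /orP[/eqP ->|us].
        rewrite eqxx; apply: (adapted_comp (g := \1_B)).
          exact: measurable_indic.
        by apply: aZ; rewrite mem_head.
      case: eqP => [ut|_]; last by apply: aZ; rewrite inE us orbT.
      by move: tsr; rewrite -ut us.
    - by move=> u w; rewrite /Z'; case: ifP.
    - move=> u; rewrite (perm_mem perm_t) inE /Z' => /orP[/eqP ->|us].
        rewrite eqxx.
        rewrite (_ : (fun _ => _) = fun w => (\1_(Z t @^-1` B) w)%:E)//.
        rewrite integral_indic// setIT.
        by rewrite (le_lt_trans (probability_le1 _ _))// ltry.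
      case: eqP => [ut|_]; last by apply: Zfin; rewrite inE us orbT.
      by move: tsr; rewrite -ut us.
    - move=> u; rewrite inE => /orP[/eqP ->|ur].
        by exists (Z t @^-1` B); apply/funext => w; rewrite /Z' eqxx.
      rewrite /Z'; case: eqP => [ut|_]; last exact: Z1.
      by move: tsr; rewrite -ut mem_cat ur orbT.
  move: IHZ; rewrite [RHS](perm_big _ perm_t)/= big_cons.
  have -> : (\prod_(u <- s ++ r) \int[P]_w (Z' u w)%:E =
      \prod_(u <- s ++ r) \int[P]_w (Z u w)%:E)%E.
    by apply: eq_big_seq => u us; apply: eq_integral => w _; rewrite Z'E.
  have -> : (\int[P]_w (Z' t w)%:E = P (Z t @^-1` B))%E.
    rewrite -[in RHS](setIT (_ @^-1` _)) -integral_indic//.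
    by apply: eq_integral => w _; rewrite /Z' eqxx.
  move=> <-; apply: eq_integral => w _.
  rewrite [in RHS](perm_big _ perm_t)/= big_cons; congr (_ * _)%:E.
    by rewrite /Z' eqxx.
  by apply: eq_big_seq => u us; rewrite Z'E.
have IW : (\int[P]_w (W w)%:E = \prod_(u <- s ++ r) \int[P]_w (Z u w)%:E)%E.
  have := IH_indic setT measurableT; rewrite preimage_setT probability_setT mul1e.
  by move=> <-; apply: eq_integral => w _; rewrite indicT mul1r.
rewrite big_cons -IW -ge0_indep_integralM//.
- by apply: eq_integral => w _; rewrite big_cons.
- by apply: mZ; rewrite mem_head.
- suff : (\prod_(u <- s ++ r) \int[P]_w (Z u w)%:E)%E \is a fin_num.
    by rewrite fin_numElt IW => /andP[].
  rewrite big_seq; apply: (big_ind (fun x : \bar R => x \is a fin_num)) => //.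
    exact: fin_numM.
  move=> u us; rewrite ge0_fin_numE ?Zfin ?inE ?us ?orbT//.
  by apply: integral_ge0 => w _; rewrite lee_fin.
- by move=> B mB; rewrite IW; exact: IH_indic.
Qed.

Definition upd (Z : I -> T -> R) t f u : T -> R := if u == t then f else Z u.

Lemma prod_upd (s r : seq I) t Z f (F : (T -> R) -> R) : uniq (t :: s ++ r) ->
  \prod_(u <- s ++ t :: r) F (upd Z t f u) = F f * \prod_(u <- s ++ r) F (Z u).
Proof.
move=> /= /andP[tsr _]; have perm_t : perm_eq (s ++ t :: r) (t :: s ++ r).
  exact: permEl (perm_catCA s [:: t] r).
rewrite (perm_big _ perm_t)/= big_cons {1}/upd eqxx; congr (_ * _).
apply: eq_big_seq => u us; rewrite /upd; case: eqP => // ut.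
by move: tsr; rewrite -ut us.
Qed.

Lemma indep_integrable_prod (s : seq I) (Z : I -> T -> R) :
  uniq s -> (forall t, t \in s -> adapted t (Z t)) ->
  (forall t, t \in s -> L1 (Z t)) ->
  L1 (fun w => \prod_(t <- s) Z t w).
Proof.
move=> us aZ iZ; apply/integrableP; split.
  apply/measurable_EFinP/measurable_prod => t ts.
  exact/(@adapted_measurable t)/aZ.
under eq_integral do rewrite /= normr_prod.
have := @ge0_indep_integral_prod s [::] (fun t w => `|Z t w|).
rewrite !cats0 => ->//.
- suff : (\prod_(t <- s) \int[P]_w `|Z t w|%:E)%E \is a fin_num.
    by rewrite fin_numElt => /andP[].
  rewrite big_seq; apply: (big_ind (fun x : \bar R => x \is a fin_num)) => //.
    exact: fin_numM.
  move=> t ts; rewrite ge0_fin_numE; first by have /integrableP[] := iZ t ts.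
  by apply: integral_ge0 => w _; rewrite lee_fin.
- by move=> t ts; apply: (adapted_comp (g := fun x => `|x|)) => //; apply: aZ.
- by move=> t /iZ/integrableP[].
Qed.

(** The same two-list induction, now removing signs: [r] holds nonnegative factors, and the head of
    [s] is split into its positive and negative parts, which are functions of it and hence still
    adapted. *)
Lemma indep_mean_prod (s r : seq I) (Z : I -> T -> R) :
  uniq (s ++ r) -> (forall t, t \in s ++ r -> adapted t (Z t)) ->
  (forall t, t \in s ++ r -> L1 (Z t)) ->
  (forall t, t \in r -> forall w, 0 <= Z t w) ->
  mean (fun w => \prod_(t <- s ++ r) Z t w) = \prod_(t <- s ++ r) mean (Z t).
Proof.
elim: s r Z => [|t s IH] r Z /=.
  move=> ur aZ iZ Z0; have := @ge0_indep_integral_prod r [::] (fun t w => `|Z t w|).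
  rewrite !cats0 => /(_ ur) H.
  rewrite /Rintegral.
  under eq_integral => w _.
    rewrite (eq_big_seq (fun t => `|Z t w|)); last first.
      by move=> t tr; rewrite ger0_norm// Z0.
    over.
  rewrite H//.
  - transitivity (\prod_(t <- r) fine (\int[P]_w `|Z t w|%:E)).
      rewrite {H ur}; elim: r aZ iZ Z0 => [|t r IH] aZ iZ Z0.
        by rewrite !big_nil.
      rewrite !big_cons fineM ?IH//.
      - by move=> u ur; apply: aZ; rewrite inE ur orbT.
      - by move=> u ur; apply: iZ; rewrite inE ur orbT.
      - by move=> u ur; apply: Z0; rewrite inE ur orbT.
      - rewrite ge0_fin_numE; last by apply: integral_ge0 => w _; rewrite lee_fin.
        by have /integrableP[] := iZ t (mem_head _ _).
      rewrite big_seq; apply: (big_ind (fun x : \bar R => x \is a fin_num)) => //.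
        exact: fin_numM.
      move=> u ur; rewrite ge0_fin_numE; last by apply: integral_ge0 => w _; rewrite lee_fin.
      by have /integrableP[] := iZ u (mem_behead (s := t :: r) ur).
    apply: eq_big_seq => t tr; congr fine; apply: eq_integral => w _.
    by rewrite ger0_norm// Z0.
  - by move=> t tr; apply: (adapted_comp (g := fun x => `|x|)) => //; apply: aZ.
  - by move=> t /iZ/integrableP[].
move=> utsr aZ iZ Z0.
have usr : uniq (s ++ t :: r).
  by rewrite (perm_uniq (permEl (perm_catCA s [:: t] r))).
have msr u : u \in s ++ t :: r -> u = t \/ u != t /\ u \in s ++ r.
  rewrite (perm_mem (permEl (perm_catCA s [:: t] r))) inE => /orP[/eqP|us]; first by left.
  right; split => //; apply: contraTneq us => ->.
  by move: utsr => /= /andP[].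
have upd_t f : adapted t f -> L1 f -> (forall w, 0 <= f w) ->
    L1 (fun w => f w * \prod_(u <- s ++ r) Z u w) /\
    mean (fun w => f w * \prod_(u <- s ++ r) Z u w) =
    mean f * \prod_(u <- s ++ r) mean (Z u).
  move=> af jf f0.
  have aU u : u \in s ++ t :: r -> adapted u (upd Z t f u).
    move=> /msr[->|[/negbTE ut us]]; first by rewrite /upd eqxx.
    by rewrite /upd ut; apply: aZ; rewrite inE us orbT.
  have iU u : u \in s ++ t :: r -> L1 (upd Z t f u).
    move=> /msr[->|[/negbTE ut us]]; first by rewrite /upd eqxx.
    by rewrite /upd ut; apply: iZ; rewrite inE us orbT.
  have E w : \prod_(u <- s ++ t :: r) upd Z t f u w =
      f w * \prod_(u <- s ++ r) Z u w.
    exact: (prod_upd _ _ (fun X => X w) utsr).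
  split.
    have := indep_integrable_prod usr aU iU.
    by apply: eq_integrable => // w _ /=; rewrite E.
  rewrite -(prod_upd _ _ (fun X => mean X) utsr) -IH//.
    by apply: eq_Rintegral => w _; rewrite E.
  move=> u; rewrite inE => /orP[/eqP ->|ur] w; first by rewrite /upd eqxx.
  by rewrite /upd; case: ifP => // _; exact: Z0.
have at_ : adapted t (Z t) by apply: aZ; rewrite mem_head.
have it : L1 (Z t) by apply: iZ; rewrite mem_head.
have mpos : measurable_fun setT (fun x : R => Num.max x 0).
  exact: measurable_maxr.
have mneg : measurable_fun setT (fun x : R => Num.max (- x) 0).
  by apply: measurable_maxr => //; exact: measurable_oppr.
have max_ge0 (g : T -> R) w : 0 <= Num.max (g w) 0 by rewrite le_max lexx orbT.
have [ip mp] := upd_t _ (adapted_comp mpos at_)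
  (integrable_funrpos measurableT it) (max_ge0 _).
have [iN mN] := upd_t _ (adapted_comp mneg at_)
  (integrable_funrneg measurableT it) (max_ge0 _).
rewrite big_cons.
have ZE w : Z t w = Num.max (Z t w) 0 - Num.max (- Z t w) 0.
  by have [|] := leP (Z t w) 0; have [|] := leP (- Z t w) 0; lra.
transitivity (mean (fun w => Num.max (Z t w) 0 * \prod_(u <- s ++ r) Z u w) -
    mean (fun w => Num.max (- Z t w) 0 * \prod_(u <- s ++ r) Z u w)).
  rewrite -RintegralB//; apply: eq_Rintegral => w _.
  by rewrite big_cons -mulrBl -ZE.
rewrite mp mN -mulrBl; congr (_ * _).
rewrite -RintegralB//.
- by apply: eq_Rintegral => w _ /=; rewrite -ZE.
- exact: (integrable_funrpos measurableT it).
- exact: (integrable_funrneg measurableT it).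
Qed.

End Independence.

(** * Fourth moments of Gaussian variables *)

Section Gaussian.
Context (R : realType).
Local Notation mu := (@lebesgue_measure R).

(* Comparing with the density of twice the standard deviation bounds the fourth moment
   without computing any integral. *)
Lemma normal_pdf_moment4_le (m s x : R) : s != 0 ->
  (x - m) ^+ 4 * normal_pdf m s x <= 64 * s ^+ 4 * normal_pdf m (2 * s) x.
Proof.
move=> s0; have s20 : 2 * s != 0 by rewrite mulf_neq0.
rewrite !normal_pdfE// /normal_fun.
have -> : normal_peak (2 * s) = 2^-1 * normal_peak s.
  rewrite /normal_peak -invfM; congr (_^-1).
  rewrite exprMn -mulrA -mulrnAr sqrtrM ?sqr_ge0//.
  by rewrite sqrtr_sqr ger0_norm.
(* In terms of [a] the two exponents are [- 4 a] and [- a], and doubling [s] halves the peak. What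
   remains is [2 a^2 <= exp (3 a)], obtained by cubing [1 + a <= exp a]. *)
set a := (x - m) ^+ 2 / (8 * s ^+ 2).
have a0 : 0 <= a by rewrite divr_ge0 ?sqr_ge0// mulr_ge0 ?sqr_ge0.
have -> : - (x - m) ^+ 2 / (s ^+ 2 *+ 2) = - a + - (a *+ 3).
  by rewrite /a; field.
have -> : - (x - m) ^+ 2 / ((2 * s) ^+ 2 *+ 2) = - a.
  by rewrite /a; field.
have -> : (x - m) ^+ 4 = 64 * s ^+ 4 * a ^+ 2 by rewrite /a; field.
rewrite expRD.
have h : 2 * a ^+ 2 * expR (- (a *+ 3)) <= 1.
  rewrite expRN ler_pdivrMr ?expR_gt0// mul1r -[a *+ 3]mulr_natr expRM_natr.
  have ha : 1 + a <= expR a by exact: expR_ge1Dx.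
  apply: (@le_trans _ _ ((1 + a) ^+ 3)); last by rewrite lerXn2r ?nnegrE ?expR_ge0//; lra.
  by nra.
have p0 : 0 <= 64 * s ^+ 4 * normal_peak s * expR (- a) / 2.
  apply: divr_ge0 => //; apply: mulr_ge0; last exact: expR_ge0.
  apply: mulr_ge0; last exact: normal_peak_ge0.
  by apply: mulr_ge0 => //; exact: exprn_even_ge0.
have := ler_wpM2l p0 h; rewrite mulr1 => h'.
rewrite [leRHS](_ : _ = 64 * s ^+ 4 * normal_peak s * expR (- a) / 2); last by ring.
by apply: le_trans h'; rewrite le_eqVlt; apply/orP; left; apply/eqP; field.
Qed.

Context (disp : measure_display) (T : measurableType disp).
Variable P : probability T R.

Lemma ge0_expectation_normal (X : T -> R) (m s : R) :
  measurable_fun setT X ->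
  (forall A, measurable A -> P (X @^-1` A) = normal_prob m s A) ->
  forall phi : R -> R, measurable_fun setT phi -> (forall x, 0 <= phi x) ->
  (\int[P]_w (phi (X w))%:E = \int[mu]_x (phi x * normal_pdf m s x)%:E)%E.
Proof.
move=> mX lawX phi mphi phi0.
pose X' : {RV P >-> R} := HB.pack X (isMeasurableFun.Build _ _ _ _ X mX).
transitivity (\int[distribution P X']_y (phi y)%:E)%E.
  by rewrite ge0_integral_distribution//; apply/measurable_EFinP.
apply: (@ge0_integral_density _ _ _ _ _ mu (distribution P X') idfun
  (normal_pdf m s)) => //.
- exact: measurable_id.
- exact: measurable_normal_pdf.
- by move=> x; exact: normal_pdf_ge0.
- move=> B mB; rewrite -[LHS]/(P (X @^-1` B)) lawX// /normal_prob.
  rewrite [LHS]integral_mkcond/=. apply: eq_integral => x _.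
  by rewrite patchE indicE; case: ifP; rewrite ?mul1r ?mul0r.
Qed.

(* A second moment 1 forces P(|X| <= 2) >= 3/4, so the density cannot be too flat. *)
Lemma normal_law_variance_bound (X : T -> R) (m s : R) : s != 0 ->
  measurable_fun setT X ->
  (forall A, measurable A -> P (X @^-1` A) = normal_prob m s A) ->
  (\int[P]_w (X w ^+ 2)%:E = 1)%E -> s ^+ 2 <= 8.
Proof.
move=> s0 mX lawX X2.
have mX2 : measurable_fun setT (fun w => X w ^+ 2) by exact: measurable_funX.
pose A : set R := `[-2, 2]%classic.
have mA : measurable A by exact: measurable_itv.
have mXA : measurable (X @^-1` A).
  by rewrite -[X in measurable X]setTI; exact: mX.
(* Chebyshev at level 2, from the pointwise bound [1 <= 1_A(X) + X^2 / 4]. *)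
have h1 : (1 <= P (X @^-1` A) + (4^-1)%:E)%E.
  rewrite -[leLHS](probability_setT P) -[X in (X <= _)%E]mul1e.
  rewrite -integral_cst//.
  have -> : (4^-1)%:E = (\int[P]_w (4^-1 * X w ^+ 2)%:E)%E.
    under eq_integral do rewrite EFinM.
    rewrite ge0_integralZl_EFin ?X2 ?mule1//.
      by move=> w _; rewrite lee_fin sqr_ge0.
    by apply/measurable_EFinP.
  rewrite -[X @^-1` A]setIT -integral_indic//.
  rewrite -ge0_integralD//.
  - apply: ge0_le_integral => //.
    + apply: emeasurable_funD; first by apply/measurable_EFinP; exact: measurable_indic.
      by apply/measurable_EFinP; exact: measurable_funM.
    + move=> w _; rewrite -EFinD lee_fin indicE.
      have [|] := boolP (w \in X @^-1` A) => /=.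
        by move=> _; have := sqr_ge0 (X w); lra.
      rewrite notin_setE /A/= in_itv/= => /negP; rewrite negb_and -!ltNge.
      by move=> /orP[|] ?; nra.
  - apply/measurable_EFinP; exact: measurable_indic.
  - by move=> w _; rewrite lee_fin mulr_ge0 ?sqr_ge0.
  - by apply/measurable_EFinP; exact: measurable_funM.
have h2 : (P (X @^-1` A) <= (4 * normal_peak s)%:E)%E.
  rewrite lawX// /normal_prob.
  apply: (@le_trans _ _ (\int[mu]_(x in A) (normal_peak s)%:E)%E).
    apply: ge0_le_integral => //.
    - by move=> x _; rewrite lee_fin normal_pdf_ge0.
    - apply/measurable_EFinP; apply: measurable_funTS; exact: measurable_normal_pdf.
    - by move=> x _; rewrite lee_fin; exact: normal_pdf_ub.
  rewrite integral_cst//= lebesgue_measure_itv/= lte_fin.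
  rewrite ifT; last by lra.
  by rewrite -EFinB -EFinM lee_fin; lra.
have h3 : 3 <= 16 * normal_peak s.
  have := le_trans h1 (leeD2r (4^-1)%:E h2).
  by rewrite -EFinD lee_fin; lra.
have sp0 : 0 < s ^+ 2 * pi *+ 2.
  by rewrite mulrn_wgt0// mulr_gt0 ?pi_gt0// exprn_even_gt0.
have q0 : 0 < Num.sqrt (s ^+ 2 * pi *+ 2) by rewrite sqrtr_gt0.
have h4 : 3 * Num.sqrt (s ^+ 2 * pi *+ 2) <= 16.
  by move: h3; rewrite /normal_peak ler_pdivlMr.
have h5 := sqr_sqrtr (ltW sp0).
have pi2 : 2 <= pi :> R by exact: pi_ge2.
have s2 : 0 <= s ^+ 2 := sqr_ge0 s.
set q := Num.sqrt _ in q0 h4 h5 *.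
(* [q <= 16 / 3] gives [2 pi s^2 = q^2 <= 32], and [pi >= 2] turns this into [s^2 <= 8]. *)
have h6 : q ^+ 2 <= 32 by nra.
move: h6; rewrite h5 mulr2n => h6; nra.
Qed.

(** The parameters are bounded through the second moment. [C] bounds [E (X - m)^4 <= 64 s^4] by
    [s^2 <= 8]; integrating [m^2 <= 2 X^2 + 1 + (X - m)^4] gives [m^2 <= 3 + C]; and
    [X^4 <= 8 (X - m)^4 + 8 m^4] yields the constant. *)
Lemma gaussian_moment4_bound : exists2 K : R, 0 <= K &
  forall X : T -> R, measurable_fun setT X ->
  (exists m s : R, forall A, measurable A ->
     P (X @^-1` A) = gaussian_law m s A) ->
  (\int[P]_w (X w ^+ 2)%:E = 1 -> \int[P]_w (X w ^+ 4)%:E <= K%:E)%E.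
Proof.
pose C : R := 64 * 8 ^+ 2; have C0 : 0 <= C by rewrite /C; lra.
exists (8 * C + 8 * (3 + C) ^+ 2).
  by rewrite addr_ge0// mulr_ge0// sqr_ge0.
move=> X mX [m [s lawX]] X2.
have mX2 : measurable_fun setT (fun w => X w ^+ 2) by exact: measurable_funX.
have mX4 : measurable_fun setT (fun w => X w ^+ 4) by exact: measurable_funX.
have mid2 : measurable_fun setT (fun x : R => x ^+ 2) by exact: measurable_funX.
have mid4 : measurable_fun setT (fun x : R => x ^+ 4) by exact: measurable_funX.
have x4_ge0 (x : R) : 0 <= x ^+ 4.
  exact: exprn_even_ge0.
(* Degenerate case: the law is the Dirac mass at [m], so [m^2 = 1] and the fourth moment is 1. *)
have [s0|s0] := eqVneq s 0.
  pose X' : {RV P >-> R} := HB.pack X (isMeasurableFun.Build _ _ _ _ X mX).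
  have E (phi : R -> R) : measurable_fun setT phi -> (forall x, 0 <= phi x) ->
      (\int[P]_w (phi (X w))%:E = (phi m)%:E)%E.
    move=> mphi phi0.
    transitivity (\int[distribution P X']_y (phi y)%:E)%E.
      by rewrite ge0_integral_distribution//; apply/measurable_EFinP.
    rewrite (eq_measure_integral (dirac m)); last first.
      move=> A mA _; rewrite -[LHS]/(P (X @^-1` A)) lawX// /gaussian_law.
      by rewrite s0 eqxx.
    by rewrite integral_dirac ?diracT ?mul1e//; apply/measurable_EFinP.
  move: X2; rewrite (E (fun x => x ^+ 2))// => [[m2]|x]; last exact: sqr_ge0.
  rewrite (E (fun x => x ^+ 4))// lee_fin.
  have -> : m ^+ 4 = (m ^+ 2) ^+ 2 by rewrite -exprM.
  rewrite m2 expr1n; nra.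
have lawX' A : measurable A -> P (X @^-1` A) = normal_prob m s A.
  by move=> mA; rewrite lawX// /gaussian_law (negbTE s0).
have s2 := normal_law_variance_bound s0 mX lawX' X2.
have mc4 : measurable_fun setT (fun x : R => (x - m) ^+ 4).
  by apply: measurable_funX; exact: measurable_funB.
have mXc4 : measurable_fun setT (fun w => (X w - m) ^+ 4).
  by apply: measurable_funX; exact: measurable_funB.
have c4 : (\int[P]_w ((X w - m) ^+ 4)%:E <= C%:E)%E.
  rewrite (ge0_expectation_normal mX lawX' mc4)//.
  apply: (@le_trans _ _
      (\int[mu]_x (64 * s ^+ 4 * normal_pdf m (2 * s) x)%:E)%E).
    apply: ge0_le_integral => //.
    - by move=> x _; rewrite lee_fin mulr_ge0// normal_pdf_ge0.
    - apply/measurable_EFinP/measurable_funM => //.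
      exact: measurable_normal_pdf.
    - apply/measurable_EFinP/measurable_funM => //.
      exact: measurable_normal_pdf.
    - by move=> x _; rewrite lee_fin; exact: normal_pdf_moment4_le.
  under eq_integral do rewrite EFinM.
  rewrite ge0_integralZl_EFin//.
  - rewrite integral_normal_pdf mule1 lee_fin /C.
    have -> : s ^+ 4 = (s ^+ 2) ^+ 2 by rewrite -exprM.
    by have := sqr_ge0 s; nra.
  - by move=> x _; rewrite lee_fin normal_pdf_ge0.
  - apply/measurable_EFinP; exact: measurable_normal_pdf.
  - by rewrite mulr_ge0.
have m2 : m ^+ 2 <= 3 + C.
  rewrite -lee_fin.
  apply: (@le_trans _ _ (\int[P]_w (2 * X w ^+ 2 + (1 + (X w - m) ^+ 4))%:E)%E).
    rewrite -[leLHS]mule1 -(probability_setT P) -integral_cst//.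
    apply: ge0_le_integral => //.
    - by move=> w _; rewrite lee_fin sqr_ge0.
    - apply/measurable_EFinP; apply: measurable_funD.
        exact: measurable_funM.
      exact: measurable_funD.
    - move=> w _; rewrite lee_fin.
      have -> : (X w - m) ^+ 4 = ((X w - m) ^+ 2) ^+ 2 by rewrite -exprM.
      have h1 := sqr_ge0 (X w - m).
      have h2 : m ^+ 2 <= 2 * X w ^+ 2 + 2 * (X w - m) ^+ 2.
        by have := sqr_ge0 (2 * X w - m); nra.
      by have := sqr_ge0 ((X w - m) ^+ 2 - 1); nra.
  under eq_integral do rewrite EFinD.
  rewrite ge0_integralD//; last 4 first.
  - by move=> w _; rewrite lee_fin mulr_ge0 ?sqr_ge0.
  - by apply/measurable_EFinP; exact: measurable_funM.
  - by move=> w _; rewrite lee_fin addr_ge0.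
  - by apply/measurable_EFinP; exact: measurable_funD.
  under eq_integral do rewrite EFinM.
  rewrite ge0_integralZl_EFin//; last 2 first.
  - by move=> w _; rewrite lee_fin sqr_ge0.
  - by apply/measurable_EFinP.
  rewrite X2 mule1.
  under eq_integral do rewrite EFinD.
  rewrite ge0_integralD//; last 2 first.
  - by move=> w _; rewrite lee_fin.
  - by apply/measurable_EFinP.
  rewrite integral_cst//= probability_setT mule1 addeA -EFinD.
  by rewrite [leRHS]EFinD leeD// lee_fin; lra.
apply: (@le_trans _ _
    (\int[P]_w (8 * (X w - m) ^+ 4 + 8 * m ^+ 4)%:E)%E).
  apply: ge0_le_integral => //.
  - by move=> w _; rewrite lee_fin.
  - by apply/measurable_EFinP.
  - apply/measurable_EFinP; apply: measurable_funD => //.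
    exact: measurable_funM.
  - move=> w _; rewrite lee_fin.
    have -> : X w ^+ 4 = ((X w - m + m) ^+ 2) ^+ 2 by rewrite subrK -exprM.
    have -> : (X w - m) ^+ 4 = ((X w - m) ^+ 2) ^+ 2 by rewrite -exprM.
    have -> : m ^+ 4 = (m ^+ 2) ^+ 2 by rewrite -exprM.
    set u := X w - m.
    have h1 : (u + m) ^+ 2 <= 2 * (u ^+ 2 + m ^+ 2).
      by have := sqr_ge0 (u - m); nra.
    apply: (@le_trans _ _ ((2 * (u ^+ 2 + m ^+ 2)) ^+ 2)).
      by rewrite lerXn2r ?nnegrE ?sqr_ge0// mulr_ge0// addr_ge0 ?sqr_ge0.
    by have := sqr_ge0 (u ^+ 2 - m ^+ 2); nra.
under eq_integral do rewrite EFinD.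
rewrite ge0_integralD//; last 3 first.
- by move=> w _; rewrite lee_fin mulr_ge0.
- by apply/measurable_EFinP; exact: measurable_funM.
- by move=> w _; rewrite lee_fin mulr_ge0.
under eq_integral do rewrite EFinM.
rewrite ge0_integralZl_EFin//; last 2 first.
- by move=> w _; rewrite lee_fin.
- by apply/measurable_EFinP.
rewrite integral_cst//= probability_setT mule1 [leRHS]EFinD leeD//.
  by rewrite EFinM lee_wpmul2l// lee_fin.
rewrite lee_fin ler_wpM2l//.
have -> : m ^+ 4 = (m ^+ 2) ^+ 2 by rewrite -exprM.
by rewrite lerXn2r ?nnegrE ?sqr_ge0//; lra.
Qed.

End Gaussian.

(** * Square-integrable random variables *)

(** Cauchy-Schwarz with weights [|c i|]: the bound depends on the l1 norm of [c] and not on the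
    number of terms. *)
Lemma sqr_sum_weighted_le (R : realType) (I : Type) (s : seq I) (c x : I -> R) :
  (\sum_(i <- s) c i * x i) ^+ 2 <=
    (\sum_(i <- s) `|c i|) * (\sum_(i <- s) `|c i| * x i ^+ 2).
Proof.
elim: s => [|i s IH]; first by rewrite !big_nil expr2 !mul0r.
rewrite !big_cons; move: IH.
set S := \sum_(j <- s) `|c j|; set V := \sum_(j <- s) `|c j| * x j ^+ 2.
set B := \sum_(j <- s) c j * x j => IH.
have S0 : 0 <= S by exact: sumr_ge0.
have V0 : 0 <= V by apply: sumr_ge0 => j _; rewrite mulr_ge0 ?sqr_ge0.
(* From [B^2 <= S V] follows [(2 B x)^2 <= 4 S V x^2 <= (S x^2 + V)^2], the last by the
   arithmetic-geometric inequality. *)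
have h : `|2 * B * x i| <= S * x i ^+ 2 + V.
  have r0 : 0 <= S * x i ^+ 2 + V by rewrite addr_ge0// mulr_ge0 ?sqr_ge0.
  rewrite -(ler_pXn2r (n := 2))// ?nnegrE// real_normK ?num_real//.
  apply: (@le_trans _ _ (4 * (S * V) * x i ^+ 2)); last first.
    by have := sqr_ge0 (S * x i ^+ 2 - V); nra.
  by have := ler_wpM2r (sqr_ge0 (x i)) IH; nra.
have hc := ler_wpM2l (normr_ge0 (c i)) h.
have c2 : `|c i| ^+ 2 = c i ^+ 2 by rewrite real_normK ?num_real.
have h2 : 2 * B * (c i * x i) <= `|c i| * `|2 * B * x i|.
  by rewrite -normrM (_ : 2 * B * (c i * x i) = c i * (2 * B * x i)) ?ler_norm//; ring.
rewrite (_ : (c i * x i + B) ^+ 2 =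
  c i ^+ 2 * x i ^+ 2 + B ^+ 2 + 2 * B * (c i * x i)); last by ring.
rewrite (_ : (`|c i| + S) * (`|c i| * x i ^+ 2 + V) =
  c i ^+ 2 * x i ^+ 2 + S * V + `|c i| * (S * x i ^+ 2 + V)); last by rewrite -c2; ring.
by rewrite lerD// ?lerD// (le_trans h2).
Qed.

Section SquareIntegrable.
Context (disp : measure_display) (T : measurableType disp) (R : realType).
Variable P : probability T R.

Local Notation L1 X := (P.-integrable [set: T] (EFin \o X)).
Local Notation mean X := (Rintegral P [set: T] X).

Lemma integrable_le (X Y : T -> R) : measurable_fun setT X ->
  (forall w, `|X w| <= Y w) -> L1 Y -> L1 X.
Proof.
move=> mX XY iY; apply: le_integrable iY => //; first by apply/measurable_EFinP.
by move=> w _; rewrite /= lee_fin (le_trans (XY w))// ler_norm.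
Qed.

Lemma integrable_ge0 (X : T -> R) (c : R) : measurable_fun setT X ->
  (forall w, 0 <= X w) -> (\int[P]_w (X w)%:E <= c%:E)%E -> L1 X.
Proof.
move=> mX X0 Xc; apply/integrableP; split; first by apply/measurable_EFinP.
under eq_integral do rewrite /= ger0_norm//.
by rewrite (le_lt_trans Xc)// ltry.
Qed.

Lemma EFin_mean (X : T -> R) : L1 X -> (mean X)%:E = (\int[P]_w (X w)%:E)%E.
Proof. by move=> iX; rewrite /Rintegral fineK//; exact: integrable_fin_num. Qed.

Lemma integrable_cstr (c : R) : L1 (fun=> c).
Proof. exact: finite_measure_integrable_cst. Qed.

Lemma mean_cst (c : R) : mean (fun=> c) = c.
Proof. by rewrite Rintegral_cst//= probability_setT mulr1. Qed.

Lemma integrableDr (X Y : T -> R) : L1 X -> L1 Y -> L1 (fun w => X w + Y w).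
Proof. by move=> iX iY; exact: (integrableD measurableT iX iY). Qed.

Lemma integrableBr (X Y : T -> R) : L1 X -> L1 Y -> L1 (fun w => X w - Y w).
Proof. by move=> iX iY; exact: (integrableB measurableT iX iY). Qed.

Lemma integrableZr (X : T -> R) c : L1 X -> L1 (fun w => c * X w).
Proof. by move=> iX; exact: (integrableZl measurableT c iX). Qed.

Lemma integrable_sumr (I : Type) (s : seq I) (X : I -> T -> R) :
  (forall i, L1 (X i)) -> L1 (fun w => \sum_(i <- s) X i w).
Proof.
move=> iX; elim: s => [|i s IH].
  by under eq_fun do rewrite big_nil; exact: integrable_cstr.
by under eq_fun do rewrite big_cons; exact: integrableDr.
Qed.

Lemma mean_sum (I : Type) (s : seq I) (X : I -> T -> R) :
  (forall i, L1 (X i)) ->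
  mean (fun w => \sum_(i <- s) X i w) = \sum_(i <- s) mean (X i).
Proof.
move=> iX; elim: s => [|i s IH].
  by under eq_Rintegral do rewrite big_nil; rewrite mean_cst big_nil.
under eq_Rintegral do rewrite big_cons.
by rewrite RintegralD// ?big_cons ?IH//; exact: integrable_sumr.
Qed.

Lemma le_mean (X Y : T -> R) : L1 X -> L1 Y -> (forall w, X w <= Y w) ->
  mean X <= mean Y.
Proof. by move=> iX iY XY; exact: le_Rintegral. Qed.

Definition sqintegrable (X : T -> R) :=
  measurable_fun setT X /\ L1 (fun w => X w ^+ 2).

Lemma sqintegrable_cst c : sqintegrable (fun=> c).
Proof. by split=> //; exact: integrable_cstr. Qed.

Lemma sqintegrable_mul X Y : sqintegrable X -> sqintegrable Y ->
  L1 (fun w => X w * Y w).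
Proof.
move=> [mX iX] [mY iY].
apply: (@integrable_le _ (fun w => X w ^+ 2 + Y w ^+ 2)).
- exact: measurable_funM.
- move=> w; rewrite ler_norml.
  have := sqr_ge0 (X w - Y w); have := sqr_ge0 (X w + Y w).
  by have := sqr_ge0 (X w); have := sqr_ge0 (Y w) => *; apply/andP; split; nra.
- exact: integrableDr.
Qed.

Lemma sqintegrable_int X : sqintegrable X -> L1 X.
Proof.
move=> sX; have := sqintegrable_mul sX (sqintegrable_cst 1).
by under eq_fun do rewrite mulr1.
Qed.

Lemma sqintegrableD X Y : sqintegrable X -> sqintegrable Y ->
  sqintegrable (fun w => X w + Y w).
Proof.
move=> sX sY; split; first by apply: measurable_funD; [case: sX|case: sY].
have -> : (fun w => (X w + Y w) ^+ 2) =
    (fun w => X w ^+ 2 + 2 * (X w * Y w) + Y w ^+ 2).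
  by apply/funext => w; ring.
apply: integrableDr; last by case: sY.
apply: integrableDr; first by case: sX.
by apply: integrableZr; exact: sqintegrable_mul.
Qed.

Lemma sqintegrableZ X c : sqintegrable X -> sqintegrable (fun w => c * X w).
Proof.
move=> [mX iX]; split; first exact: measurable_funM.
by under eq_fun do rewrite exprMn; exact: integrableZr.
Qed.

Lemma sqintegrableB X Y : sqintegrable X -> sqintegrable Y ->
  sqintegrable (fun w => X w - Y w).
Proof.
move=> sX sY; have := sqintegrableD sX (sqintegrableZ (-1) sY).
by under eq_fun do rewrite mulN1r.
Qed.

Lemma sqintegrable_sum (I : Type) (s : seq I) (X : I -> T -> R) :
  (forall i, sqintegrable (X i)) -> sqintegrable (fun w => \sum_(i <- s) X i w).
Proof.
move=> iX; elim: s => [|i s IH].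
  by under eq_fun do rewrite big_nil; exact: sqintegrable_cst.
by under eq_fun do rewrite big_cons; exact: sqintegrableD.
Qed.

End SquareIntegrable.

(** * Noise moments *)

Section Noise.
Context (disp : measure_display) (T : measurableType disp) (R : realType).
Variable P : probability T R.
Local Notation L1 X := (P.-integrable [set: T] (EFin \o X)).
Local Notation mean X := (Rintegral P [set: T] X).

Lemma sigma_vector_measurable (q : nat) (X : T -> 'cV[R]_q) (A : set T) :
  random_vector X -> sigma_vector X A -> measurable A.
Proof.
move=> mX; apply: smallest_sub; first exact: sigma_algebra_measurable.
rewrite -bigcup_seq => B [i _ [C mC <-]].
exact: mX.
Qed.

Lemma adapted_coord (I : choiceType) (q : nat) (X : I -> T -> 'cV[R]_q) t i :
  adapted (fun u => sigma_vector (X u)) t (fun w => X t w i ord0 : R).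
Proof.
move=> B mB; apply: sub_sigma_algebra; rewrite -bigcup_seq.
exists i => /=; first by rewrite mem_index_enum.
by exists B => //; rewrite setTI.
Qed.

Lemma adapted_mul (I : choiceType) (q : nat) (X : I -> T -> 'cV[R]_q) t
    (Y Z : T -> R) :
  adapted (fun u => sigma_vector (X u)) t Y ->
  adapted (fun u => sigma_vector (X u)) t Z ->
  adapted (fun u => sigma_vector (X u)) t (fun w => Y w * Z w).
Proof.
move=> aY aZ.
(* [S] is [T] equipped with the sigma-algebra generated by [X t]; adaptedness is measurability on
   [S], where products are measurable. *)
pose S := g_sigma_algebraType (\big[setU/set0]_(i < q)
  preimage_set_system setT (fun w => X t w i ord0) measurable).
have mY : measurable_fun setT (Y : S -> R) by move=> _ B mB; rewrite setTI; exact: aY.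
have mZ : measurable_fun setT (Z : S -> R) by move=> _ B mB; rewrite setTI; exact: aZ.
have mYZ := measurable_funM mY mZ.
by move=> B mB; have := mYZ measurableT B mB; rewrite setTI.
Qed.

Variables (d p : nat) (e : 'rV[int]_d -> T -> 'cV[R]_p).
Hypothesis he : white_gaussian_noise P e.
Local Notation eps t a := (fun w => e t w a ord0).

Lemma noise_measurable t a : measurable_fun setT (eps t a).
Proof. by case: he => g _ _ _; case: (g t) => + _; apply. Qed.

Lemma noise_integral_mul t a b :
  (\int[P]_w (e t w a ord0 * e t w b ord0)%:E = ((a == b)%:R)%:E)%E.
Proof.
case: he => _ m0 cov _; rewrite -(cov t a b) covariance.unlock !m0.
rewrite expectation.unlock; apply: eq_integral => w _.
congr EFin.
by rewrite -[RHS]/((e t w a ord0 - 0) * (e t w b ord0 - 0)) !subr0.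
Qed.

Lemma noise_integral_sqr t a : (\int[P]_w (e t w a ord0 ^+ 2)%:E = 1)%E.
Proof. by have := noise_integral_mul t a a; rewrite eqxx. Qed.

Lemma noise_sqintegrable t a : sqintegrable P (eps t a).
Proof.
split; first exact: noise_measurable.
apply: (@integrable_ge0 _ _ _ _ _ 1).
- by apply: measurable_funX; exact: noise_measurable.
- by move=> w; exact: sqr_ge0.
- by rewrite noise_integral_sqr.
Qed.

Lemma noise_mean t a : mean (eps t a) = 0.
Proof. by case: he => _ m0 _ _; have := m0 t a; rewrite expectation.unlock /Rintegral => ->. Qed.

Lemma noise_mean_mul t a b : mean (fun w => e t w a ord0 * e t w b ord0) = (a == b)%:R.
Proof. by rewrite /Rintegral noise_integral_mul. Qed.

Lemma noise_moment4 : exists2 K : R, 0 <= K & forall t a,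
  L1 (fun w => e t w a ord0 ^+ 4) /\ mean (fun w => e t w a ord0 ^+ 4) <= K.
Proof.
have [K K0 HK] := gaussian_moment4_bound P; exists K => // t a.
have mE := noise_measurable t a.
have le4 : (\int[P]_w (e t w a ord0 ^+ 4)%:E <= K%:E)%E.
  apply: HK => //; last exact: noise_integral_sqr.
  (* The coordinate [a] is the linear form attached to a unit vector, hence Gaussian. *)
  case: he => g _ _ _; case: (g t) => _ /(_ (delta_mx a ord0)) [m [s H]].
  exists m, s => A mA; rewrite -H//; congr (P _).
  apply/seteqP; split => w /=; rewrite mxE (bigD1 a)//= !mxE !eqxx mul1r big1 ?addr0//;
    by move=> j ja; rewrite !mxE (negbTE ja) mul0r.
have i4 : L1 (fun w => e t w a ord0 ^+ 4).
  apply: (@integrable_ge0 _ _ _ _ _ K) => //.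
    exact: measurable_funX.
  by move=> w; exact: exprn_even_ge0.
by split=> //; rewrite -lee_fin EFin_mean.
Qed.

Lemma noise_mul_sqintegrable t a u b :
  sqintegrable P (fun w => e t w a ord0 * e u w b ord0).
Proof.
have mt := noise_measurable t a; have mu := noise_measurable u b.
split; first exact: measurable_funM.
have [K K0 HK] := noise_moment4.
apply: (@integrable_le _ _ _ _ _ (fun w => e t w a ord0 ^+ 4 + e u w b ord0 ^+ 4)).
- by apply: measurable_funX; exact: measurable_funM.
- move=> w; rewrite ger0_norm ?sqr_ge0//.
  have := sqr_ge0 (e t w a ord0 ^+ 2 - e u w b ord0 ^+ 2).
  rewrite exprMn; have := exprn_even_ge0 (n := 4) (e t w a ord0) isT.
  have := exprn_even_ge0 (n := 4) (e u w b ord0) isT.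
  by move: (e t w a ord0) (e u w b ord0) => x y; nra.
- by apply: integrableDr; [case: (HK t a)|case: (HK u b)].
Qed.

Lemma noise_indep_prod (s : seq 'rV[int]_d) (Z : 'rV[int]_d -> T -> R) : uniq s ->
  (forall t, t \in s -> adapted (fun u => sigma_vector (e u)) t (Z t)) ->
  (forall t, t \in s -> L1 (Z t)) ->
  mean (fun w => \prod_(t <- s) Z t w) = \prod_(t <- s) mean (Z t).
Proof.
case: he => g _ _ ind us aZ iZ.
have := @indep_mean_prod _ _ _ P _ (fun u => sigma_vector (e u)) _ ind s [::] Z.
rewrite !cats0; apply => // t A; apply: sigma_vector_measurable.
by case: (g t).
Qed.

Lemma noise_mean_mul_neq t u a b : t != u ->
  mean (fun w => e t w a ord0 * e u w b ord0) = 0.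
Proof.
move=> tu; pose Z v := if v == t then eps t a else eps u b.
have ut : (u == t) = false by rewrite eq_sym; exact: negbTE.
have := @noise_indep_prod [:: t; u] Z.
rewrite /= inE tu => /(_ isT).
rewrite !big_cons !big_nil /Z eqxx ut !noise_mean mul0r.
move=> <-.
- by apply: eq_Rintegral => w _; rewrite !big_cons !big_nil eqxx ut mulr1.
- move=> v; rewrite !inE => /orP[] /eqP ->; rewrite ?eqxx ?ut; exact: adapted_coord.
- move=> v; rewrite !inE => /orP[] /eqP ->; rewrite ?eqxx ?ut;
  exact/sqintegrable_int/noise_sqintegrable.
Qed.

(** At four distinct times the mean factorizes and the centred factor at [t] kills it. [Z] is
    indexed by time, with coordinate [a] at [t] and [s] and [b] elsewhere. *)
Lemma noise_mean_prod4 t u s v a b : uniq [:: t; u; s; v] ->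
  mean (fun w => (e t w a ord0 * e u w b ord0) * (e s w a ord0 * e v w b ord0)) = 0.
Proof.
move=> uq; pose Z x := if (x == t) || (x == s) then eps x a else eps x b.
move: (uq); rewrite /= !inE !negb_or.
move=> /andP[/and3P[tu ts tv] /andP[/andP[us uv] /andP[sv _]]].
have Zt : Z t = eps t a by rewrite /Z eqxx.
have Zu : Z u = eps u b by rewrite /Z eq_sym (negbTE tu) (negbTE us).
have Zs : Z s = eps s a by rewrite /Z eqxx orbT.
have Zv : Z v = eps v b.
  by rewrite /Z eq_sym (negbTE tv) eq_sym (negbTE sv).
have := @noise_indep_prod [:: t; u; s; v] Z uq.
rewrite !big_cons !big_nil Zt noise_mean mul0r => <-.
- by apply: eq_Rintegral => w _; rewrite !big_cons !big_nil Zt Zu Zs Zv mulr1 !mulrA.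
- by move=> x _; rewrite /Z; case: ifP => _; exact: adapted_coord.
- by move=> x _; rewrite /Z; case: ifP => _; exact/sqintegrable_int/noise_sqintegrable.
Qed.

(** Both coordinates at one time form a single factor adapted to that time, of mean 0 or 1; the
    square of such a mean is itself. *)
Lemma noise_mean_prod22 t s a b : t != s ->
  mean (fun w => (e t w a ord0 * e t w b ord0) * (e s w a ord0 * e s w b ord0))
    = (a == b)%:R.
Proof.
move=> ts; pose Z x w := e x w a ord0 * e x w b ord0.
have := @noise_indep_prod [:: t; s] Z.
rewrite /= inE ts => /(_ isT).
rewrite !big_cons !big_nil mulr1 /Z !noise_mean_mul.
move=> H; transitivity ((a == b)%:R * (a == b)%:R : R); last by case: eqP; rewrite ?mulr1 ?mulr0.
rewrite -H.
- by apply: eq_Rintegral => w _; rewrite !big_cons !big_nil mulr1.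
- by move=> x _; apply: adapted_mul; exact: adapted_coord.
- by move=> x _; exact/sqintegrable_int/noise_mul_sqintegrable.
Qed.

End Noise.

(** * Finite linear combinations of the noise *)

Lemma sum_pred1_le (R : realType) (I : eqType) (s : seq I) (v : I) : uniq s ->
  \sum_(i <- s) (i == v)%:R <= 1 :> R.
Proof.
move=> us; rewrite -natr_sum -[leRHS]/(1%:R) ler_nat.
rewrite (_ : (\sum_(i <- s) (i == v))%N = count_mem v s).
  by rewrite count_uniq_mem// leq_b1.
by rewrite -sum1_count [RHS]big_mkcond; apply: eq_bigr => i _ /=; case: (i == v).
Qed.

Section LinearField.
Context (disp : measure_display) (T : measurableType disp) (R : realType).
Variable P : probability T R.
Local Notation L1 X := (P.-integrable [set: T] (EFin \o X)).
Local Notation mean X := (Rintegral P [set: T] X).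
Variables (d p : nat) (e : 'rV[int]_d -> T -> 'cV[R]_p).
Hypothesis he : white_gaussian_noise P e.
Local Notation idx := ('rV[int]_d * 'I_p)%type.

(** An index [x = (s, a)] pairs a filter shift with a noise coordinate, so that a coordinate of the
    filtered field is a scalar linear combination over indices. *)
Definition noise_at (x : idx) (t : 'rV[int]_d) (w : T) : R := e (t - x.1) w x.2 ord0.

(** Covariance of [noise_at x] at time [t + k] with [noise_at x'] at time [t]: the test says that
    both read the same noise variable, with [t] cancelled. *)
Definition noise_cov (x x' : idx) (k : 'rV[int]_d) : R :=
  ((k - x.1 == - x'.1) && (x.2 == x'.2))%:R.

Definition lin (r : seq idx) (c : idx -> R) (t : 'rV[int]_d) (w : T) : R :=
  \sum_(x <- r) c x * noise_at x t w.

Definition lin_cov (r : seq idx) (c c' : idx -> R) (k : 'rV[int]_d) : R :=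
  \sum_(x <- r) \sum_(x' <- r) c x * c' x' * noise_cov x x' k.

Lemma lin_sqintegrable r c t : sqintegrable P (lin r c t).
Proof.
apply: sqintegrable_sum => x; apply: sqintegrableZ; exact: noise_sqintegrable.
Qed.

Lemma noise_at_mul_sqintegrable x x' k t :
  sqintegrable P (fun w => noise_at x (t + k) w * noise_at x' t w).
Proof. exact: noise_mul_sqintegrable. Qed.

Lemma noise_at_mean_mul x x' k t :
  mean (fun w => noise_at x (t + k) w * noise_at x' t w) = noise_cov x x' k.
Proof.
rewrite /noise_cov /noise_at; case: eqP => /= [kx|kx].
  by rewrite -addrA kx; exact: noise_mean_mul.
apply: noise_mean_mul_neq => //; apply/eqP => h; apply: kx.
by move: h; rewrite -addrA => /addrI.
Qed.

Lemma lin_mul r c c' k t w : lin r c (t + k) w * lin r c' t w =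
  \sum_(z <- [seq (x, x') | x <- r, x' <- r])
     (c z.1 * c' z.2) * (noise_at z.1 (t + k) w * noise_at z.2 t w).
Proof.
rewrite big_allpairs big_distrlr/=; apply: eq_bigr => x _; apply: eq_bigr => x' _.
by ring.
Qed.

Lemma lin_covE r c c' k : lin_cov r c c' k =
  \sum_(z <- [seq (x, x') | x <- r, x' <- r])
     (c z.1 * c' z.2) * noise_cov z.1 z.2 k.
Proof. by rewrite big_allpairs. Qed.

Lemma lin_mean_mul r c c' k t :
  mean (fun w => lin r c (t + k) w * lin r c' t w) = lin_cov r c c' k.
Proof.
under eq_Rintegral do rewrite lin_mul.
rewrite mean_sum; last first.
  by move=> z; apply: integrableZr; exact/sqintegrable_int/noise_at_mul_sqintegrable.
rewrite lin_covE; apply: eq_bigr => z _.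
rewrite RintegralZl ?noise_at_mean_mul//.
exact/sqintegrable_int/noise_at_mul_sqintegrable.
Qed.

Lemma noise_cov_sum_le (x x' : idx) (K : seq 'rV[int]_d) : uniq K ->
  \sum_(k <- K) noise_cov x x' k <= 1.
Proof.
move=> uK; apply: (@le_trans _ _ (\sum_(k <- K) (k == x.1 - x'.1)%:R)).
  apply: ler_sum => k _; rewrite /noise_cov ler_nat.
  have -> : (k - x.1 == - x'.1) = (k == x.1 - x'.1).
    by rewrite subr_eq addrC.
  by case: eqP => //= _; case: eqP.
exact: sum_pred1_le.
Qed.

(** After exchanging the sums, each pair of indices contributes to a single lag. The bound is free
    of [K] and of the number of indices, so it survives the limit. *)
Lemma sum_lin_cov_le r c c' (K : seq 'rV[int]_d) : uniq K ->
  \sum_(k <- K) `|lin_cov r c c' k| <=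
    (\sum_(x <- r) `|c x|) * (\sum_(x <- r) `|c' x|).
Proof.
move=> uK.
apply: (@le_trans _ _ (\sum_(k <- K) \sum_(x <- r) \sum_(x' <- r)
    `|c x| * `|c' x'| * noise_cov x x' k)).
  apply: ler_sum => k _; apply: (le_trans (ler_norm_sum _ _ _)).
  apply: ler_sum => x _; apply: (le_trans (ler_norm_sum _ _ _)).
  by apply: ler_sum => x' _; rewrite !normrM (ger0_norm (ler0n _ _)).
rewrite exchange_big/= big_distrlr/=; apply: ler_sum => x _.
rewrite exchange_big/=; apply: ler_sum => x' _.
by rewrite -mulr_sumr ler_piMr ?mulr_ge0// noise_cov_sum_le.
Qed.

Lemma noise_product_cov_bound : exists2 C : R, 0 <= C & forall x x' k t s,
  `|mean (fun w => (noise_at x (t + k) w * noise_at x' t w - noise_cov x x' k) *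
     (noise_at x (s + k) w * noise_at x' s w - noise_cov x x' k))| <= C.
Proof.
have [K K0 HK] := noise_moment4 he.
(* With [g] equal to 0 or 1, [(a b - g)^2 <= 2 a^2 b^2 + 2 g^2 <= a^4 + b^4 + 2], whose mean is at
   most [2 K + 2]. *)
exists (2 * K + 2) => [|x x' k t s]; first by rewrite addr_ge0// mulr_ge0.
set g := noise_cov x x' k.
have g01 : g ^+ 2 <= 1 by rewrite /g /noise_cov; case: (_ && _); rewrite ?expr1n ?expr0n.
have sqY u : sqintegrable P (fun w => noise_at x (u + k) w * noise_at x' u w - g).
  by apply: sqintegrableB; [exact: noise_at_mul_sqintegrable|exact: sqintegrable_cst].
have iY2 u := (sqY u).2.
have Y2 u : mean (fun w => (noise_at x (u + k) w * noise_at x' u w - g) ^+ 2) <= 2 * K + 2.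
  have [i1 m1] := HK (u + k - x.1) x.2; have [i2 m2] := HK (u - x'.1) x'.2.
  apply: (@le_trans _ _ (mean (fun w =>
      (noise_at x (u + k) w ^+ 4 + noise_at x' u w ^+ 4) + 2))).
    apply: le_mean => //.
      by apply: integrableDr; [exact: integrableDr|exact: integrable_cstr].
    move=> w; move: (noise_at x (u + k) w) (noise_at x' u w) => a b.
    have -> : a ^+ 4 = (a ^+ 2) ^+ 2 by rewrite -exprM.
    have -> : b ^+ 4 = (b ^+ 2) ^+ 2 by rewrite -exprM.
    have h1 := sqr_ge0 (a ^+ 2 - b ^+ 2); have h2 := sqr_ge0 (a * b + g).
    have -> : (a * b - g) ^+ 2 = 2 * ((a ^+ 2) * (b ^+ 2)) + 2 * g ^+ 2 - (a * b + g) ^+ 2 by ring.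
    by nra.
  rewrite RintegralD//; [|exact: integrableDr|exact: integrable_cstr].
  rewrite RintegralD// mean_cst.
  by rewrite /noise_at; lra.
have mf f : L1 f -> (forall w, `|f w| <=
      2^-1 * ((noise_at x (t + k) w * noise_at x' t w - g) ^+ 2 +
        (noise_at x (s + k) w * noise_at x' s w - g) ^+ 2)) ->
    mean f <= 2 * K + 2.
  move=> jf fle.
  apply: (@le_trans _ _ (mean (fun w =>
      2^-1 * ((noise_at x (t + k) w * noise_at x' t w - g) ^+ 2 +
        (noise_at x (s + k) w * noise_at x' s w - g) ^+ 2)))).
    apply: le_mean => //.
      by apply: integrableZr; exact: integrableDr.
    by move=> w; exact: le_trans (ler_norm _) (fle w).
  rewrite RintegralZl//; last exact: integrableDr.
  by rewrite RintegralD//; have := Y2 t; have := Y2 s; lra.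
have iYY := sqintegrable_mul (sqY t) (sqY s).
have YYle w : `|(noise_at x (t + k) w * noise_at x' t w - g) *
      (noise_at x (s + k) w * noise_at x' s w - g)| <=
   2^-1 * ((noise_at x (t + k) w * noise_at x' t w - g) ^+ 2 +
        (noise_at x (s + k) w * noise_at x' s w - g) ^+ 2).
  move: (_ - g) (_ - g) => a b.
  rewrite ler_norml; have := sqr_ge0 (a - b); have := sqr_ge0 (a + b) => *.
  by apply/andP; split; nra.
apply: le_trans (le_normr_Rintegral _ iYY) _ => //.
apply: mf; first exact: integrable_norm.
by move=> w; rewrite normr_id.
Qed.

(* Two products at times t and s involve disjoint noise positions unless
   s is one of t, t + h, t - h, where h is the offset between the factors. *)
Lemma noise_at_uncorrelated x x' k t s : s != t ->
  s + k - x.1 != t - x'.1 -> t + k - x.1 != s - x'.1 ->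
  mean (fun w => (noise_at x (t + k) w * noise_at x' t w - noise_cov x x' k) *
     (noise_at x (s + k) w * noise_at x' s w - noise_cov x x' k)) = 0.
Proof.
move=> st h1 h2; set g := noise_cov x x' k.
have i u : sqintegrable P (fun w => noise_at x (u + k) w * noise_at x' u w).
  exact: noise_at_mul_sqintegrable.
have it := sqintegrable_int (i t); have is_ := sqintegrable_int (i s).
have its := sqintegrable_mul (i t) (i s).
transitivity (mean (fun w => (noise_at x (t + k) w * noise_at x' t w) *
    (noise_at x (s + k) w * noise_at x' s w)) - g ^+ 2).
  pose A w := noise_at x (t + k) w * noise_at x' t w.
  pose B w := noise_at x (s + k) w * noise_at x' s w.
  transitivity (mean (fun w => (A w * B w - (g * A w + g * B w)) + g ^+ 2)).
    by apply: eq_Rintegral => w _; rewrite /A /B; ring.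
  have igA : L1 (fun w => g * A w) by exact: integrableZr.
  have igB : L1 (fun w => g * B w) by exact: integrableZr.
  rewrite RintegralD//; [|by apply: integrableBr => //; exact: integrableDr|exact: integrable_cstr].
  rewrite RintegralB//; last exact: integrableDr.
  have mA : mean A = g := noise_at_mean_mul x x' k t.
  have mB : mean B = g := noise_at_mean_mul x x' k s.
  have mgA : mean (fun w => g * A w) = g * g by rewrite RintegralZl// mA.
  have mgB : mean (fun w => g * B w) = g * g by rewrite RintegralZl// mB.
  rewrite RintegralD// mgA mgB mean_cst.
  by rewrite /A /B; ring.
(* Either the two factors of each product share their time, and both sides equal the 0-1 value [g],
   or the four times are distinct and everything vanishes. *)
have [kx|kx] := eqVneq (k - x.1) (- x'.1).
  rewrite /noise_at -!addrA kx noise_mean_prod22//; last first.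
    by apply: contra st => /eqP /addIr ->.
  by rewrite /g /noise_cov kx eqxx; case: eqP => _; rewrite ?expr1n ?expr0n subrr.
rewrite /noise_at noise_mean_prod4//.
  by rewrite /g /noise_cov (negbTE kx)/= expr0n subr0.
have neq (a b c : 'rV[int]_d) : a != b -> a + c != b + c.
  by apply: contra => /eqP /addIr ->.
have kx' v : v + k - x.1 != v - x'.1.
  by apply: contra kx => /eqP; rewrite -addrA => /addrI ->.
have ts : t != s by rewrite eq_sym.
rewrite /= !inE !negb_or !kx' h2 (eq_sym (t - x'.1)) h1 (neq _ _ _ ts).
by rewrite (neq _ _ _ (neq _ _ _ ts)).
Qed.

(** In the expanded square each [t] meets at most three correlated times, [t], [t - u] and [t + u],
    each with covariance at most [C]; hence [3 * C] per time. *)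
Lemma noise_at_sum_variance : exists2 C : R, 0 <= C & forall x x' k (Xi : seq 'rV[int]_d),
  uniq Xi ->
  mean (fun w => (\sum_(t <- Xi)
     (noise_at x (t + k) w * noise_at x' t w - noise_cov x x' k)) ^+ 2)
  <= C * (size Xi)%:R.
Proof.
have [C C0 HC] := noise_product_cov_bound; exists (3 * C) => [|x x' k Xi uX];
  first by rewrite mulr_ge0.
pose Y t w := noise_at x (t + k) w * noise_at x' t w - noise_cov x x' k.
have sqY u : sqintegrable P (Y u).
  by apply: sqintegrableB; [exact: noise_at_mul_sqintegrable|exact: sqintegrable_cst].
have iYY t s := sqintegrable_mul (sqY t) (sqY s).
apply: (@le_trans _ _ (\sum_(t <- Xi) \sum_(s <- Xi) mean (fun w => Y t w * Y s w))).
  rewrite le_eqVlt; apply/orP; left; apply/eqP.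
  under eq_Rintegral do rewrite expr2 big_distrlr/=.
  rewrite mean_sum => [|t]; last by apply: integrable_sumr => s; exact: iYY.
  by apply: eq_bigr => t _; rewrite mean_sum// => s; exact: iYY.
pose u := k - x.1 + x'.1.
apply: (@le_trans _ _ (\sum_(t <- Xi) \sum_(s <- Xi)
    C * ((s == t)%:R + ((s == t - u)%:R + (s == t + u)%:R)))).
  apply: ler_sum => t _; apply: ler_sum => s _.
  have h : mean (fun w => Y t w * Y s w) <= C := le_trans (ler_norm _) (HC _ _ _ _ _).
  have [_|st] := eqVneq s t.
    by rewrite (le_trans h)// ler_peMr// lerDl addr_ge0.
  have [_|h1] := eqVneq s (t - u).
    by rewrite (le_trans h)// ler_peMr// add0r lerDl.
  have [_|h2] := eqVneq s (t + u).
    by rewrite (le_trans h)// ler_peMr// !add0r.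
  rewrite noise_at_uncorrelated//.
  - by rewrite !addr0 mulr0.
  - apply: contra h1 => /eqP h'; rewrite /u; apply/eqP.
    by apply: (canRL (addrK _)); rewrite 2!addrA h' subrK.
  - apply: contra h2 => /eqP h'; rewrite /u; apply/eqP.
    by rewrite addrA addrA h' subrK.
have cnt v : \sum_(s <- Xi) (s == v)%:R <= 1 :> R.
  exact: sum_pred1_le.
rewrite -sum1_size natr_sum mulr_sumr; apply: ler_sum => t _; rewrite mulr1.
rewrite -mulr_sumr !big_split/= mulrC ler_wpM2r//.
by have := cnt t; have := cnt (t - u); have := cnt (t + u); lra.
Qed.

(** The centred sum is a combination over pairs of indices, and the l1 norm of the coefficients
    [c z.1 * c' z.2] is the product of the two l1 norms. [C] is chosen before [r], [c] and [c'],
    which makes the bound stable under approximation. *)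
Lemma lin_mul_variance : exists2 C : R, 0 <= C & forall r c c' k (Xi : seq 'rV[int]_d),
  uniq Xi ->
  L1 (fun w => (\sum_(t <- Xi)
    (lin r c (t + k) w * lin r c' t w - lin_cov r c c' k)) ^+ 2) /\
  mean (fun w => (\sum_(t <- Xi)
    (lin r c (t + k) w * lin r c' t w - lin_cov r c c' k)) ^+ 2)
  <= ((\sum_(x <- r) `|c x|) * (\sum_(x <- r) `|c' x|)) ^+ 2 * (C * (size Xi)%:R).
Proof.
have [C C0 HC] := noise_at_sum_variance; exists C => // r c c' k Xi uX.
pose q := [seq (x, x') | x <- r, x' <- r].
pose cz (z : idx * idx) := c z.1 * c' z.2.
pose Y (z : idx * idx) w := \sum_(t <- Xi)
  (noise_at z.1 (t + k) w * noise_at z.2 t w - noise_cov z.1 z.2 k).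
have sqY z : sqintegrable P (Y z).
  apply: sqintegrable_sum => t.
  by apply: sqintegrableB; [exact: noise_at_mul_sqintegrable|exact: sqintegrable_cst].
have SE w : \sum_(t <- Xi) (lin r c (t + k) w * lin r c' t w - lin_cov r c c' k)
    = \sum_(z <- q) cz z * Y z w.
  under eq_bigr do rewrite lin_mul lin_covE -sumrB.
  rewrite exchange_big/=; apply: eq_bigr => z _; rewrite mulr_sumr.
  by apply: eq_bigr => t _; rewrite mulrBr.
rewrite (_ : (fun w => (\sum_(t <- Xi)
    (lin r c (t + k) w * lin r c' t w - lin_cov r c c' k)) ^+ 2) =
  fun w => (\sum_(z <- q) cz z * Y z w) ^+ 2); last first.
  by apply/funext => w; rewrite SE.
have sqS : sqintegrable P (fun w => \sum_(z <- q) cz z * Y z w).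
  by apply: sqintegrable_sum => z; exact: sqintegrableZ.
split; first exact: sqS.2.
have SA : \sum_(z <- q) `|cz z| = (\sum_(x <- r) `|c x|) * (\sum_(x <- r) `|c' x|).
  rewrite big_allpairs big_distrlr/=; apply: eq_bigr => x _; apply: eq_bigr => x' _.
  by rewrite normrM.
rewrite -SA; set A := \sum_(z <- q) `|cz z|.
have A0 : 0 <= A by exact: sumr_ge0.
apply: (@le_trans _ _ (mean (fun w => A * \sum_(z <- q) `|cz z| * Y z w ^+ 2))).
  apply: le_mean; first exact: sqS.2.
    apply: integrableZr; apply: integrable_sumr => z; apply: integrableZr.
    exact: (sqY z).2.
  by move=> w; exact: sqr_sum_weighted_le.
rewrite RintegralZl//; last first.
  by apply: integrable_sumr => z; apply: integrableZr; exact: (sqY z).2.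
rewrite expr2 -mulrA ler_wpM2l//.
rewrite mean_sum; last by move=> z; apply: integrableZr; exact: (sqY z).2.
rewrite mulr_suml; apply: ler_sum => z _.
by rewrite RintegralZl//; [rewrite ler_wpM2l//; exact: HC|exact: (sqY z).2].
Qed.

End LinearField.

(** * Passing to the mean-square limit *)

Section EventuallyFset.
Variable I : choiceType.
Implicit Types Q : {fset I} -> Prop.

(** The filter [summability.totally] in explicit form, convenient for meeting finitely many
    approximation demands with one finite set. *)
Definition eventually_fset Q := exists F0 : {fset I}, forall F, (F0 `<=` F)%fset -> Q F.

Lemma eventually_fset_and Q1 Q2 : eventually_fset Q1 -> eventually_fset Q2 ->
  eventually_fset (fun F => Q1 F /\ Q2 F).
Proof.
move=> [F1 H1] [F2 H2]; exists (F1 `|` F2)%fset => F; rewrite fsubUset => /andP[? ?].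
by split; [exact: H1|exact: H2].
Qed.

Lemma eventually_fset_mono Q1 Q2 : (forall F, Q1 F -> Q2 F) ->
  eventually_fset Q1 -> eventually_fset Q2.
Proof. by move=> Q12 [F0 H]; exists F0 => F /H/Q12. Qed.

Lemma eventually_fset_all (J : eqType) (s : seq J) (Q : J -> {fset I} -> Prop) :
  (forall j, eventually_fset (Q j)) ->
  eventually_fset (fun F => forall j, j \in s -> Q j F).
Proof.
move=> H; elim: s => [|j s IH]; first by exists fset0.
apply: eventually_fset_mono (eventually_fset_and (H j) IH) => F [Hj Hs] i.
by rewrite inE => /orP[/eqP ->//|]; exact: Hs.
Qed.

Lemma eventually_fset_ex Q : eventually_fset Q -> exists F, Q F.
Proof. by move=> [F0 H]; exists F0; exact: H. Qed.

Lemma totally_eventually Q : summability.totally Q <-> eventually_fset Q.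
Proof. by split=> [[F0 _ H]|[F0 H]]; exists F0. Qed.

End EventuallyFset.

Section Approximation.
Context (disp : measure_display) (T : measurableType disp) (R : realType).
Variable P : probability T R.
Local Notation L1 X := (P.-integrable [set: T] (EFin \o X)).
Local Notation mean X := (Rintegral P [set: T] X).

(* Fatou-type bound without extracting an a.e. convergent subsequence: for |S| <= K,
   S^2 = S'^2 + 2 S (S - S') - (S - S')^2 <= S'^2 + 2 K |S - S'|. *)
Lemma sqr_mean_le_approx (S : T -> R) (B : R) : measurable_fun setT S ->
  (forall delta, 0 < delta -> exists S' : T -> R,
     [/\ sqintegrable P S', mean (fun w => S' w ^+ 2) <= B,
         L1 (fun w => S w - S' w) & mean (fun w => `|S w - S' w|) <= delta]) ->
  L1 (fun w => S w ^+ 2) /\ mean (fun w => S w ^+ 2) <= B.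
Proof.
move=> mS H.
have mS2 : measurable_fun setT (fun w => S w ^+ 2) by exact: measurable_funX.
(* Truncating at [|S| <= K] makes the cross term [2 S (S - S')] controllable by the L1 error. *)
pose Z (K : nat) w : R := S w ^+ 2 * \1_(`[- K%:R, K%:R]%classic : set R) (S w).
have mZ K : measurable_fun setT (Z K).
  by apply: measurable_funM => //; exact: measurableT_comp.
have ZE K w : Z K w = if `|S w| <= K%:R then S w ^+ 2 else 0.
  rewrite /Z indicE; have -> : (S w \in (`[- K%:R, K%:R]%classic : set R)) = (`|S w| <= K%:R).
    by rewrite ler_norml; apply/idP/idP; rewrite inE/= in_itv.
  by case: ifP; rewrite ?mulr1 ?mulr0.
have Z0 K w : 0 <= Z K w by rewrite ZE; case: ifP; rewrite ?sqr_ge0.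
have ZB K : (\int[P]_w (Z K w)%:E <= B%:E)%E.
  apply/lee_addgt0Pr => eta eta0.
  (* [K + 1] instead of [K] keeps the divisor positive at [K = 0]. *)
  have K1 : 0 < 2 * (K%:R + 1) :> R by rewrite mulr_gt0// ltr_wpDl.
  have [S' [[mS' iS'2] S'B iD Dle]] := H (eta / (2 * (K%:R + 1))) (divr_gt0 eta0 K1).
  have iD' : L1 (fun w => `|S w - S' w|) by exact: integrable_norm.
  have iU : L1 (fun w => S' w ^+ 2 + 2 * (K%:R + 1) * `|S w - S' w|).
    by apply: integrableDr => //; exact: integrableZr.
  apply: (@le_trans _ _ (\int[P]_w (S' w ^+ 2 + 2 * (K%:R + 1) * `|S w - S' w|)%:E)%E).
    apply: ge0_le_integral => //.
    - by move=> w _; rewrite lee_fin.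
    - by apply/measurable_EFinP.
    - exact: measurable_int iU.
    - move=> w _; rewrite lee_fin ZE.
      have h0 : 0 <= 2 * (K%:R + 1) * `|S w - S' w| by rewrite mulr_ge0// ltW.
      case: ifP => [SK|_]; last by rewrite addr_ge0 ?sqr_ge0.
      have h1 : S w * (S w - S' w) <= (K%:R + 1) * `|S w - S' w|.
        rewrite (le_trans (ler_norm _))// normrM ler_wpM2r//.
        by rewrite (le_trans SK)// lerDl.
      by have := sqr_ge0 (S w - S' w); nra.
  rewrite -EFin_mean// RintegralD//; last exact: integrableZr.
  rewrite RintegralZl// -EFinD lee_fin lerD//.
  by rewrite mulrC -ler_pdivlMr.
(* The bound does not depend on [K], so the truncation is removed by monotone convergence. *)
have SB : (\int[P]_w (S w ^+ 2)%:E <= B%:E)%E.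
  have Zcvg w : (Z K w)%:E @[K --> \oo] --> (S w ^+ 2)%:E.
    apply: cvg_near_cst; near=> K; rewrite ZE ifT//.
    by near: K; exact: nbhs_infty_ger.
  rewrite (_ : (\int[P]_w (S w ^+ 2)%:E =
      limn (fun K => \int[P]_w (Z K w)%:E))%E); last first.
    rewrite -monotone_convergence//.
    - by apply: eq_integral => w _; apply/esym/cvg_lim => //; exact: Zcvg.
    - by move=> K; apply/measurable_EFinP.
    - by move=> K w _; rewrite lee_fin.
    - move=> w _ a b ab; rewrite lee_fin !ZE.
      case: ifP => [Sa|_]; last by case: ifP; rewrite ?sqr_ge0.
      by rewrite ifT// (le_trans Sa)// ler_nat.
  apply: lime_le; last exact: nearW.
  apply: ereal_nondecreasing_is_cvgn => a b ab; apply: ge0_le_integral => //.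
  - by move=> w _; rewrite lee_fin.
  - by apply/measurable_EFinP.
  - by apply/measurable_EFinP.
  - move=> w _; rewrite lee_fin !ZE.
    case: ifP => [Sa|_]; last by case: ifP; rewrite ?sqr_ge0.
    by rewrite ifT// (le_trans Sa)// ler_nat.
have iS : L1 (fun w => S w ^+ 2).
  by apply: (integrable_ge0 mS2 _ SB) => w; exact: sqr_ge0.
by split=> //; rewrite -lee_fin EFin_mean.
Unshelve. all: by end_near.
Qed.

(** With [x = a - a'] and [y = b - b'], the difference of products is [x b + a y - x y]. Young's
    inequality with parameter [h] bounds [x b] by half of [h^-1 x^2 + h b^2], so errors of size
    [h^2] in mean square cost only [O(h)]. Capping [h] at 1 gives [h^2 <= h]. *)
Lemma mean_norm_mul_sub_le (a b a' b' : T -> R) (V delta : R) :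
  0 < delta -> sqintegrable P a -> sqintegrable P b ->
  sqintegrable P a' -> sqintegrable P b' ->
  mean (fun w => a w ^+ 2) <= V -> mean (fun w => b w ^+ 2) <= V ->
  mean (fun w => (a w - a' w) ^+ 2) <= Num.min delta 1 ^+ 2 ->
  mean (fun w => (b w - b' w) ^+ 2) <= Num.min delta 1 ^+ 2 ->
  mean (fun w => `|a w * b w - a' w * b' w|) <= delta * (V + 2).
Proof.
move=> delta0; set h := Num.min delta 1 => sa sb sa' sb' aV bV aa bb.
have h0 : 0 < h by rewrite lt_min delta0 ltr01.
have hd : h <= delta by rewrite ge_min lexx.
have h1 : h <= 1 by rewrite ge_min lexx orbT.
have sA := sqintegrableB sa sa'; have sB := sqintegrableB sb sb'.
have [_ iA] := sA; have [_ iB] := sB; have [_ ia] := sa; have [_ ib] := sb.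
pose U w := 2^-1 * (((a w - a' w) ^+ 2 + (b w - b' w) ^+ 2) +
  (h^-1 * ((a w - a' w) ^+ 2 + (b w - b' w) ^+ 2) + h * (a w ^+ 2 + b w ^+ 2))).
have iAB := integrableDr iA iB; have iab := integrableDr ia ib.
have iU1 := integrableZr h^-1 iAB; have iU2 := integrableZr h iab.
have iU12 := integrableDr iU1 iU2; have iU3 := integrableDr iAB iU12.
have V0 : 0 <= V by rewrite (le_trans _ aV)// Rintegral_ge0// => w _; exact: sqr_ge0.
apply: (@le_trans _ _ (mean U)).
  apply: le_mean.
  - apply: integrable_norm; apply: integrableBr; exact: sqintegrable_mul.
  - exact: integrableZr.
  - move=> w; rewrite /U; move: (a w) (b w) (a' w) (b' w) => u1 v1 u2 v2.
    set x := u1 - u2; set y := v1 - v2.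
    have -> : u1 * v1 - u2 * v2 = x * v1 + u1 * y - x * y by rewrite /x /y; ring.
    have young u v : `|u * v| <= 2^-1 * (h^-1 * u ^+ 2 + h * v ^+ 2).
      have e1 : (u * v) = (h^-1 * u) * (h * v).
        by rewrite mulrACA mulVf ?mul1r// gt_eqF.
      have k1 : h^-1 * u ^+ 2 = h * (h^-1 * u) ^+ 2 by field; rewrite gt_eqF.
      rewrite k1 e1; move: (h^-1 * u) => u'.
      have := mulr_ge0 (ltW h0) (sqr_ge0 (u' - v)).
      have := mulr_ge0 (ltW h0) (sqr_ge0 (u' + v)).
      by rewrite ler_norml => *; apply/andP; split; nra.
    have y1 : `|x * y| <= 2^-1 * (x ^+ 2 + y ^+ 2).
      rewrite ler_norml; have := sqr_ge0 (x - y); have := sqr_ge0 (x + y) => *.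
      by apply/andP; split; nra.
    have y2 := young x v1; have y3 := young y u1.
    rewrite (le_trans (ler_normB _ _))//.
    have := ler_normD (x * v1) (u1 * y); rewrite (mulrC u1 y).
    by nra.
rewrite /U (RintegralZl 2^-1 measurableT iU3) (RintegralD measurableT iAB iU12).
rewrite (RintegralD measurableT iU1 iU2) (RintegralZl _ measurableT iAB).
rewrite (RintegralZl _ measurableT iab) (RintegralD measurableT iA iB).
rewrite (RintegralD measurableT ia ib).
move: aa bb; set mA := mean _; set mB := mean _ => aa bb.
have hh : h^-1 * (mA + mB) <= 2 * h.
  by rewrite mulrC ler_pdivrMr//; nra.
have h2 : h * (mean (fun w => a w ^+ 2) + mean (fun w => b w ^+ 2)) <= h * (2 * V).
  by rewrite ler_pM2l//; lra.
have h3 : h ^+ 2 <= h by nra.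
have h4 : h * V <= delta * V by rewrite ler_wpM2r.
by lra.
Qed.

End Approximation.

Lemma frobenius_sqr (R : realType) (m n : nat) (A : 'M[R]_(m, n)) :
  frobenius A ^+ 2 = \sum_i \sum_j A i j ^+ 2.
Proof.
by rewrite sqr_sqrtr// sumr_ge0// => i _; rewrite sumr_ge0// => j _; exact: sqr_ge0.
Qed.

Lemma sqr_entry_le (R : realType) (m n : nat) (A : 'M[R]_(m, n)) i j :
  A i j ^+ 2 <= \sum_i \sum_j A i j ^+ 2.
Proof.
rewrite (bigD1 i)//= (bigD1 j)//= -addrA lerDl addr_ge0//.
  by rewrite sumr_ge0// => k _; exact: sqr_ge0.
by rewrite sumr_ge0// => k _; rewrite sumr_ge0// => l _; exact: sqr_ge0.
Qed.

Lemma entry_le_frobenius (R : realType) (m n : nat) (A : 'M[R]_(m, n)) i j :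
  `|A i j| <= frobenius A.
Proof.
rewrite -(ler_pXn2r (n := 2))// ?nnegrE ?sqrtr_ge0//.
by rewrite real_normK ?num_real// frobenius_sqr; exact: sqr_entry_le.
Qed.

Lemma esum_fset_bound (R : realType) (I : choiceType) (a : I -> R) :
  (forall i, 0 <= a i) -> (\esum_(i in [set: I]) (a i)%:E < +oo)%E ->
  exists2 A, 0 <= A & forall F : {fset I}, \sum_(i <- F) a i <= A.
Proof.
move=> a0 aoo; exists (fine (\esum_(i in [set: I]) (a i)%:E)%E).
  by rewrite fine_ge0// esum_ge0// => i _; rewrite lee_fin.
move=> F; rewrite -lee_fin fineK; last first.
  by rewrite ge0_fin_numE// esum_ge0// => i _; rewrite lee_fin.
apply: esum_ge; exists [set` F]; first by split.
by rewrite fsbig_finite//= set_fsetK sumEFin.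
Qed.

(** * Covariances of the filtered field and variance of its lag sums *)

Section FilteredNoise.
Context (disp : measure_display) (T : measurableType disp) (R : realType).
Variable P : probability T R.
Local Notation L1 X := (P.-integrable [set: T] (EFin \o X)).
Local Notation mean X := (Rintegral P [set: T] X).
Variables (d m p : nat) (M : 'rV[int]_d -> 'M[R]_(m, p)).
Variables (e : 'rV[int]_d -> T -> 'cV[R]_p) (y : 'rV[int]_d -> T -> 'cV[R]_m).
Hypothesis hM : (\esum_(s in [set: 'rV[int]_d]) (frobenius (M s))%:E < +oo)%E.
Hypothesis he : white_gaussian_noise P e.
Hypothesis hy : filtered_noise P M e y.

Let coef (i : 'I_m) (x : 'rV[int]_d * 'I_p) : R := M x.1 i x.2.
Let idxs (F : {fset 'rV[int]_d}) := [seq (s, a) | s <- F, a <- enum 'I_p].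

Let partial_lin F t w i : lin e (idxs F) (coef i) t w =
  (\sum_(s <- F) M s *m e (t - s) w) i ord0.
Proof.
rewrite /lin big_allpairs summxE; apply: eq_bigr => s _.
by rewrite mxE big_enum.
Qed.

(** Each of the [p] entries in a row of [M s] is at most its Frobenius norm. This is how summability
    of [M] enters all constants below, uniformly in [F]. *)
Let coef_bound : exists2 A, 0 <= A & forall F i, \sum_(x <- idxs F) `|coef i x| <= A.
Proof.
have [A A0 HA] := esum_fset_bound (fun s => sqrtr_ge0 _) hM.
exists (p%:R * A) => [|F i]; first by rewrite mulr_ge0.
rewrite big_allpairs.
apply: (@le_trans _ _ (\sum_(s <- F) p%:R * frobenius (M s))).
  apply: ler_sum => s _; rewrite big_enum/=.
  apply: (@le_trans _ _ (\sum_(a < p) frobenius (M s))).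
    by apply: ler_sum => a _; exact: entry_le_frobenius.
  by rewrite sumr_const card_ord mulr_natl.
by rewrite -mulr_sumr ler_wpM2l// HA.
Qed.

Let y_measurable t i : measurable_fun setT (fun w => y t w i ord0).
Proof. by case: (hy t). Qed.

(** For large [F] the expected Frobenius error is below [delta], and one coordinate is a summand of
    it. The same bound supplies square integrability of the error, from which that of [y] is then
    deduced. *)
Let approx_error t (delta : R) : 0 < delta -> eventually_fset (fun F => forall i,
  sqintegrable P (fun w => y t w i ord0 - lin e (idxs F) (coef i) t w) /\
  mean (fun w => (y t w i ord0 - lin e (idxs F) (coef i) t w) ^+ 2) <= delta).
Proof.
move=> delta0; case: (hy t) => my cy.
have := cy _ (open_ereal_lt' (y := delta%:E) (x := 0%E) _).
rewrite lte_fin => /(_ delta0)/totally_eventually.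
apply: eventually_fset_mono => F /=; rewrite expectation.unlock => Hlt i.
pose X j w := y t w j ord0 - lin e (idxs F) (coef j) t w.
have mX j : measurable_fun setT (X j).
  apply: measurable_funB => //; exact: (lin_sqintegrable he _ _ _).1.
have Xle : (\int[P]_w (X i w ^+ 2)%:E <= delta%:E)%E.
  apply: le_trans (ltW Hlt).
  have frobE w : frobenius (y t w - \sum_(s <- F) M s *m e (t - s) w) ^+ 2 =
      \sum_j X j w ^+ 2.
    rewrite frobenius_sqr; apply: eq_bigr => j _.
    by rewrite big_ord1 /X partial_lin !mxE.
  under [leRHS]eq_integral do rewrite frobE.
  apply: ge0_le_integral => //.
  - by move=> w _; rewrite lee_fin sqr_ge0.
  - by apply/measurable_EFinP/measurable_funX.
  - by apply/measurable_EFinP/measurable_sum => j; exact: measurable_funX.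
  - move=> w _; rewrite lee_fin (bigD1 i)//= lerDl sumr_ge0// => j _.
    exact: sqr_ge0.
have iX : L1 (fun w => X i w ^+ 2).
  apply: (integrable_ge0 _ _ Xle) => [|w]; last exact: sqr_ge0.
  exact: measurable_funX.
split; first by split; [exact: (mX i)|exact: iX].
by rewrite -lee_fin EFin_mean.
Qed.

Lemma field_sqintegrable t i : sqintegrable P (fun w => y t w i ord0).
Proof.
have [F /(_ i)[sX _]] := eventually_fset_ex (approx_error t ltr01).
have := sqintegrableD sX (lin_sqintegrable he (idxs F) (coef i) t).
by under eq_fun do rewrite subrK.
Qed.

Let yy_int t k i j : L1 (fun w => y (t + k) w i ord0 * y t w j ord0).
Proof. exact: sqintegrable_mul (field_sqintegrable _ _) (field_sqintegrable _ _). Qed.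

Let ll_int F t k i j : L1 (fun w => lin e (idxs F) (coef i) (t + k) w *
  lin e (idxs F) (coef j) t w).
Proof. by apply: sqintegrable_mul; exact: lin_sqintegrable. Qed.

Let approx_mul t k i j (delta : R) : 0 < delta -> eventually_fset (fun F =>
  mean (fun w => `|y (t + k) w i ord0 * y t w j ord0 -
     lin e (idxs F) (coef i) (t + k) w * lin e (idxs F) (coef j) t w|) <= delta).
Proof.
move=> delta0.
pose V := mean (fun w => y (t + k) w i ord0 ^+ 2) + mean (fun w => y t w j ord0 ^+ 2).
have sq_ge0 u l : 0 <= mean (fun w => y u w l ord0 ^+ 2).
  by apply: Rintegral_ge0 => w _; exact: sqr_ge0.
have V2 : 0 < V + 2 by rewrite ltr_wpDl// addr_ge0.
pose eta := delta / (V + 2); have eta0 : 0 < eta by rewrite divr_gt0.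
have h0 : 0 < Num.min eta 1 ^+ 2 by rewrite exprn_gt0// lt_min eta0 ltr01.
apply: eventually_fset_mono (eventually_fset_and (approx_error (t + k) h0)
  (approx_error t h0)) => F [/(_ i)[s1 e1] /(_ j)[s2 e2]].
rewrite [leRHS](_ : delta = eta * (V + 2)); last by rewrite divfK// gt_eqF.
apply: mean_norm_mul_sub_le => //; try exact: field_sqintegrable;
  try exact: lin_sqintegrable.
- by rewrite lerDl.
- by rewrite lerDr.
Qed.

Let approx_cov t k i j (delta : R) : 0 < delta -> eventually_fset (fun F =>
  `|mean (fun w => y (t + k) w i ord0 * y t w j ord0) -
    lin_cov (idxs F) (coef i) (coef j) k| <= delta).
Proof.
move=> /(approx_mul t k i j); apply: eventually_fset_mono => F; apply: le_trans.
rewrite -(lin_mean_mul he _ _ _ _ t) -RintegralB//.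
by apply: le_normr_Rintegral => //; exact: integrableBr.
Qed.

Lemma lag_product_entry t k w i j :
  lag_product y t k w i j = y (t + k) w i ord0 * y t w j ord0.
Proof. by rewrite /lag_product mxE big_ord1 !mxE. Qed.

Lemma lag_cov_entry t k i j :
  lag_cov P y t k i j = mean (fun w => y (t + k) w i ord0 * y t w j ord0).
Proof.
rewrite mxE expectation.unlock /Rintegral; congr fine.
by apply: eq_integral => w _; rewrite lag_product_entry.
Qed.

(** The covariances at [t] and at 0 are limits of the same [lin_cov], in which the time does not
    occur. *)
Lemma lag_cov_stationary t k : lag_cov P y t k = autocov P y k.
Proof.
apply/matrixP => i j; rewrite /autocov !lag_cov_entry.
apply/eqP; rewrite -subr_eq0 -normr_le0; apply/ler_addgt0Pr => delta delta0.
have h : 0 < delta / 2 by rewrite divr_gt0.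
have [F [H1 H2]] := eventually_fset_ex (eventually_fset_and
  (approx_cov t k i j h) (approx_cov 0 k i j h)).
have dist (a b c x : R) : `|a - c| <= x -> `|b - c| <= x -> `|a - b| <= x + x.
  move=> ac bc; rewrite (_ : a - b = (a - c) - (b - c)); last by ring.
  by rewrite (le_trans (ler_normB _ _))// lerD.
by rewrite [leRHS]add0r (le_trans (dist _ _ _ _ H1 H2))// -splitr.
Qed.

Lemma sum_autocov_le : exists2 B, 0 <= B & forall (K : {fset 'rV[int]_d}) i j,
  \sum_(k <- K) `|autocov P y k i j| <= B.
Proof.
have [A A0 HA] := coef_bound; exists (A ^+ 2) => [|K i j]; first exact: sqr_ge0.
apply/ler_addgt0Pr => delta delta0.
(* The errors over all of [K] add up to at most [delta]; the successor takes care of an empty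
   [K]. *)
have h : 0 < delta / (size K).+1%:R by rewrite divr_gt0.
have [F HF] := eventually_fset_ex (eventually_fset_all K
  (fun k => approx_cov 0 k i j h)).
apply: (@le_trans _ _ (\sum_(k <- K)
  (`|lin_cov (idxs F) (coef i) (coef j) k| + delta / (size K).+1%:R))).
  rewrite [leLHS]big_seq [leRHS]big_seq; apply: ler_sum => k /HF.
  rewrite /autocov lag_cov_entry => hk.
  set a := mean _ in hk *; set c := lin_cov _ _ _ _ in hk *.
  rewrite -lerBlDl (le_trans _ hk)//; exact: lerB_dist.
rewrite big_split/= lerD//.
  apply: le_trans (sum_lin_cov_le _ _ _ _) _; first exact: fset_uniq.
  by rewrite expr2 ler_pM ?sumr_ge0.
rewrite big_const_seq count_predT iter_addr_0 -[leLHS]mulr_natr -mulrA ler_piMr ?(ltW delta0)//.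
by rewrite mulrC ler_pdivrMr// mul1r ler_nat.
Qed.

(** The centred sums for [y] are L1 limits of those for the finite filters, whose second moments
    [lin_mul_variance] bounds uniformly in [F]; [sqr_mean_le_approx] transfers the bound. *)
Lemma lag_sum_variance : exists2 C, 0 <= C & forall (Xi : {fset 'rV[int]_d}) k i j,
  L1 (fun w => (\sum_(t <- Xi) (lag_product y t k w i j - autocov P y k i j)) ^+ 2) /\
  mean (fun w => (\sum_(t <- Xi) (lag_product y t k w i j - autocov P y k i j)) ^+ 2)
    <= C * #|` Xi|%:R.
Proof.
have [A A0 HA] := coef_bound; have [C C0 HC] := lin_mul_variance he.
exists ((A * A) ^+ 2 * C) => [|Xi k i j]; first by rewrite mulr_ge0 ?sqr_ge0.
set rho := autocov P y k i j.
rewrite (_ : (fun w => (\sum_(t <- Xi) (lag_product y t k w i j - rho)) ^+ 2) =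
    (fun w => (\sum_(t <- Xi) (y (t + k) w i ord0 * y t w j ord0 - rho)) ^+ 2));
    last first.
  apply/funext => w; congr (_ ^+ 2); apply: eq_bigr => t _.
  by rewrite lag_product_entry.
apply: sqr_mean_le_approx.
  apply: measurable_sum => t; apply: measurable_funB => //.
  by apply: measurable_funM; exact: y_measurable.
move=> delta delta0.
(* The factor 2 shares the error at each time between the product and its centring constant. *)
have h : 0 < delta / (2 * (size Xi).+1%:R) by rewrite divr_gt0 ?mulr_gt0.
have [F [Hcov Hmul]] := eventually_fset_ex (eventually_fset_and
  (approx_cov 0 k i j h) (eventually_fset_all Xi (fun t => approx_mul t k i j h))).
pose L t w := lin e (idxs F) (coef i) (t + k) w * lin e (idxs F) (coef j) t w.
pose rhoF := lin_cov (idxs F) (coef i) (coef j) k.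
have [iS SC] := HC (idxs F) (coef i) (coef j) k Xi (fset_uniq Xi).
pose D t w := (y (t + k) w i ord0 * y t w j ord0 - L t w) - (rho - rhoF).
have iyL t := integrableBr (yy_int t k i j) (ll_int F t k i j).
have iD t : L1 (D t).
  by apply: integrableBr; [exact: iyL|exact: integrable_cstr].
have DE w : \sum_(t <- Xi) (y (t + k) w i ord0 * y t w j ord0 - rho) -
    \sum_(t <- Xi) (L t w - rhoF) = \sum_(t <- Xi) D t w.
  by rewrite -sumrB; apply: eq_bigr => t _; rewrite /D; ring.
exists (fun w => \sum_(t <- Xi) (L t w - rhoF)); split.
- split=> //; apply: measurable_sum => t; apply: measurable_funB => //.
  by apply: measurable_funM; exact: (lin_sqintegrable he _ _ _).1.
- apply: le_trans SC _; rewrite [leLHS]mulrA ler_wpM2r// ler_wpM2r//.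
  by rewrite lerXn2r ?nnegrE ?mulr_ge0 ?sumr_ge0// ler_pM ?sumr_ge0.
- by under eq_fun do rewrite DE; exact: integrable_sumr.
- under eq_Rintegral do rewrite DE.
  apply: (@le_trans _ _ (mean (fun w => \sum_(t <- Xi) `|D t w|))).
    apply: le_mean.
    + by apply: integrable_norm; exact: integrable_sumr.
    + by apply: integrable_sumr => t; exact: integrable_norm.
    + by move=> w; exact: ler_norm_sum.
  rewrite mean_sum => [|t]; last exact: integrable_norm.
  apply: (@le_trans _ _ (\sum_(t <- Xi) delta / (size Xi).+1%:R)).
    rewrite [leLHS]big_seq [leRHS]big_seq; apply: ler_sum => t /Hmul Ht.
    have iyL' : L1 (fun w => `|y (t + k) w i ord0 * y t w j ord0 - L t w|).
      by apply: integrable_norm; exact: iyL.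
    apply: (@le_trans _ _ (mean (fun w =>
        `|y (t + k) w i ord0 * y t w j ord0 - L t w| + `|rho - rhoF|))).
      apply: le_mean.
      + exact: integrable_norm.
      + by apply: integrableDr => //; exact: integrable_cstr.
      + by move=> w; exact: ler_normB.
    rewrite RintegralD//; last exact: integrable_cstr.
    rewrite mean_cst.
    have -> : delta / (size Xi).+1%:R = delta / (2 * (size Xi).+1%:R) +
        delta / (2 * (size Xi).+1%:R).
      by rewrite invfM mulrA mulrAC -splitr.
    apply: lerD => //.
    by move: Hcov; rewrite /rho /autocov lag_cov_entry.
  rewrite big_const_seq count_predT iter_addr_0 -[leLHS]mulr_natr -mulrA ler_piMr ?(ltW delta0)//.
  by rewrite mulrC ler_pdivrMr// mul1r ler_nat.
Qed.

End FilteredNoise.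

(** * Unconditional sums *)

Section SummableFamilies.
Variables (R : realType) (I : choiceType).
Implicit Types (a x : I -> R) (F : {fset I}).

Lemma sum_fset_subset a F0 F : (forall i, 0 <= a i) -> (F0 `<=` F)%fset ->
  \sum_(i <- F0) a i <= \sum_(i <- F) a i.
Proof.
move=> a0 F0F; rewrite [leRHS](big_fsetID _ (mem F0))/=.
have -> : [fset i in F | i \in F0]%fset = F0.
  by apply/fsetP => i; rewrite !inE/= andbC; case: (boolP (i \in F0)) => //= /(fsubsetP F0F).
by rewrite lerDl sumr_ge0.
Qed.

Lemma ge0_sum_limit a (B : R) : (forall i, 0 <= a i) ->
  (forall F, \sum_(i <- F) a i <= B) ->
  exists l, forall eps, 0 < eps ->
    eventually_fset (fun F => l - eps <= \sum_(i <- F) a i <= l).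
Proof.
move=> a0 aB; pose S := [set \sum_(i <- F) a i | F in [set: {fset I}]].
have hS : has_sup S.
  split; first by exists (\sum_(i <- fset0) a i), fset0.
  by exists B => _ [F _ <-].
exists (sup S) => eps eps0.
have [_ [F0 _ <-] hF0] := sup_adherent eps0 hS.
exists F0 => F F0F; apply/andP; split; last first.
  by apply: sup_upper_bound => //; exists F.
by rewrite (le_trans (ltW hF0))// sum_fset_subset.
Qed.

(** If the sum over [F0] is within [eps] of the supremum, a disjoint set can add at most [eps]. *)
Lemma sum_tail_small a (B : R) : (forall i, 0 <= a i) ->
  (forall F, \sum_(i <- F) a i <= B) ->
  forall eps, 0 < eps -> exists F0, forall F, (forall i, i \in F -> i \notin F0) ->
    \sum_(i <- F) a i <= eps.
Proof.
move=> a0 aB eps eps0; have [l Hl] := ge0_sum_limit a0 aB.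
have [F0 HF0] := Hl _ eps0; exists F0 => F FF0.
have /andP[h1 _] := HF0 F0 (fsubset_refl _).
have /andP[_ h2] := HF0 (F0 `|` F)%fset (fsubsetUl _ _).
move: h2; rewrite (big_fsetID _ (mem F0))/=.
have -> : [fset i in (F0 `|` F)%fset | i \in F0]%fset = F0.
  by apply/fsetP => i; rewrite !inE/= andbC; case: (i \in F0).
have -> : [fset i in (F0 `|` F)%fset | i \notin F0]%fset = F.
  apply/fsetP => i; rewrite !inE/= andbC; case: (boolP (i \in F0)) => //= iF0.
  by apply/esym/negP => /FF0; rewrite iF0.
by lra.
Qed.

(** [x = (a + x) - a] is a difference of two nonnegative families with bounded sums. *)
Lemma abs_sum_limit a x (B : R) : (forall i, `|x i| <= a i) ->
  (forall F, \sum_(i <- F) a i <= B) ->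
  exists l, forall eps, 0 < eps ->
    eventually_fset (fun F => `|l - \sum_(i <- F) x i| <= eps).
Proof.
move=> xa aB.
have a0 i : 0 <= a i by rewrite (le_trans _ (xa i)).
have ax0 i : 0 <= a i + x i.
  by have := xa i; rewrite ler_norml => /andP[? _]; lra.
have axB F : \sum_(i <- F) (a i + x i) <= B + B.
  rewrite big_split/= lerD// (le_trans _ (aB F))//; apply: ler_sum => i _.
  by rewrite (le_trans (ler_norm _)).
have [l1 H1] := ge0_sum_limit a0 aB; have [l2 H2] := ge0_sum_limit ax0 axB.
exists (l2 - l1) => eps eps0.
have h : 0 < eps / 2 by rewrite divr_gt0.
apply: eventually_fset_mono (eventually_fset_and (H1 _ h) (H2 _ h)) => F.
rewrite big_split/= => -[/andP[p1 p2] /andP[p3 p4]].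
by rewrite ler_norml; apply/andP; split; lra.
Qed.

End SummableFamilies.

(** * Complex-valued sums and Fourier terms *)

Section SpectralDensity.
Variable R : realType.
Import Normc.

Lemma normc_real (x : R) : normc (real_complex R x) = `|x|.
Proof. by rewrite /normc/= expr0n addr0 sqrtr_sqr. Qed.

Lemma normc_cexpi (x : R) : normc (cexpi x) = 1.
Proof. by rewrite /normc/= cos2Dsin2 sqrtr1. Qed.

Lemma normc_ge0 (z : R[i]) : 0 <= normc z.
Proof. by case: z => a b; exact: sqrtr_ge0. Qed.

Lemma normc_le_Re_Im (a b : R) : normc (Complex a b) <= `|a| + `|b|.
Proof.
rewrite -(ler_pXn2r (n := 2))// ?nnegrE ?normc_ge0 ?addr_ge0//.
rewrite /normc sqr_sqrtr ?addr_ge0 ?sqr_ge0// sqrrD !real_normK ?num_real//.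
by have := mulr_ge0 (normr_ge0 a) (normr_ge0 b); lra.
Qed.

Lemma normc_sum_le (I : Type) (s : seq I) (z : I -> R[i]) :
  normc (\sum_(i <- s) z i) <= \sum_(i <- s) normc (z i).
Proof.
elim: s => [|i s IH]; first by rewrite !big_nil normc0.
by rewrite !big_cons (le_trans (le_normcD _ _))// lerD2l.
Qed.

Lemma fourier_term_entry (m d : nat) (C : 'M[R]_m) (k : 'rV[int]_d) theta i j :
  fourier_term C k theta i j = cexpi (- pairing k theta) * real_complex R (C i j).
Proof. by rewrite !mxE. Qed.

Lemma normc_fourier_term (m d : nat) (C : 'M[R]_m) (k : 'rV[int]_d) theta i j :
  normc (fourier_term C k theta i j) = `|C i j|.
Proof. by rewrite fourier_term_entry normcM normc_cexpi mul1r normc_real. Qed.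

Lemma complex_sum_limit (I : choiceType) (a : I -> R) (z : I -> R[i]) (B : R) :
  (forall i, normc (z i) <= a i) -> (forall F : {fset I}, \sum_(i <- F) a i <= B) ->
  exists l : R[i], forall eps, 0 < eps ->
    eventually_fset (fun F => normc (l - \sum_(i <- F) z i) <= eps).
Proof.
move=> za aB.
have reE i : `|complex.Re (z i)| <= a i.
  apply: le_trans (za i); case: (z i) => x y /=.
  by rewrite -sqrtr_sqr ler_wsqrtr// lerDl sqr_ge0.
have imE i : `|complex.Im (z i)| <= a i.
  apply: le_trans (za i); case: (z i) => x y /=.
  by rewrite -sqrtr_sqr ler_wsqrtr// lerDr sqr_ge0.
have [l1 H1] := abs_sum_limit reE aB; have [l2 H2] := abs_sum_limit imE aB.
exists (Complex l1 l2) => eps eps0.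
have h : 0 < eps / 2 by rewrite divr_gt0.
apply: eventually_fset_mono (eventually_fset_and (H1 _ h) (H2 _ h)) => F [p1 p2].
have -> : \sum_(i <- F) z i =
    Complex (\sum_(i <- F) complex.Re (z i)) (\sum_(i <- F) complex.Im (z i)).
  elim: (F : seq I) => [|i r IH]; first by rewrite !big_nil.
  by rewrite !big_cons IH; case: (z i).
apply: le_trans (normc_le_Re_Im _ _) _.
by rewrite (splitr eps) lerD.
Qed.

#[local] Existing Instance summability.totally_filter.

(** [summability.sum] is defined as a limit, so by separation it is enough to exhibit entrywise
    convergence. *)
Lemma matrix_sum_eq (m n : nat) (I : choiceType) (z : I -> 'M[R[i]]_(m, n)) (L : 'M[R[i]]_(m, n)) :
  (forall i j eps, 0 < eps ->
    eventually_fset (fun F : {fset I} => normc (L i j - \sum_(k <- F) z k i j) <= eps)) ->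
  summability.sum z = L.
Proof.
move=> HL; apply: cvg_lim; first exact: norm_hausdorff.
apply/cvg_ballP => eps eps0.
(* The radius is an element of [R[i]], where positivity forces the imaginary part to vanish. *)
have [e e0 epsE] : exists2 e : R, 0 < e & eps = real_complex R e.
  case: eps eps0 => x y; rewrite ltcE/= => /andP[/eqP-> x0].
  by exists x.
have h : 0 < e / 2 by rewrite divr_gt0.
apply/totally_eventually.
have H1 : eventually_fset (fun F : {fset I} => forall i, i \in enum 'I_m ->
    forall j, j \in enum 'I_n -> normc (L i j - \sum_(k <- F) z k i j) <= e / 2).
  apply: eventually_fset_all => i; apply: eventually_fset_all => j.
  exact: HL.
apply: eventually_fset_mono H1 => F HF; split => // i j.
rewrite -ball_normE /ball_/= epsE -[ltLHS]/(real_complex R (normc _)) ltcR.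
rewrite /summability.partial_sum summxE -(big_seq_fsetE _ F predT (fun k => z k i j)).
have := HF i (mem_enum _ i) j (mem_enum _ j).
by move=> /le_lt_trans; apply; rewrite ltr_pdivrMr// ltr_pMr// ltr1n.
Qed.

End SpectralDensity.

(** * Counting lags, and the bias *)

Section Boxes.
Variable d : nat.

(** Natural side lengths let truncated subtraction produce the empty box when a lag exceeds [N], so
    one count covers both [Lambda] and [Xi]. *)
Definition box (lo : 'I_d -> int) (c : 'I_d -> nat) : set 'rV[int]_d :=
  [set t | forall j, (lo j <= t ord0 j) && (t ord0 j < lo j + (c j)%:Z)].

Lemma box_card lo c : finite_set (box lo c) /\
  #|` fset_set (box lo c)| = (\prod_j c j)%N.
Proof.
pose gT : finType := {dffun forall j : 'I_d, 'I_(c j)}.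
pose h (g : gT) : 'rV[int]_d := \row_j (lo j + (g j : nat)%:Z).
pose E := [fset h g | g in enum {: gT}]%fset.
have boxE : box lo c = [set` E].
  apply/seteqP; split => t /=.
    move=> ht; pose g : gT := [ffun j => @Ordinal (c j) `|t ord0 j - lo j|%N
      (ltac:(have := ht j; lia))].
    apply/imfsetP; exists g; first by rewrite /= mem_enum.
    by apply/rowP => j; rewrite mxE ffunE/= -[t 0 j]/(t ord0 j); have := ht j; lia.
  by move=> /imfsetP[g _ ->] j; rewrite mxE; have := ltn_ord (g j); lia.
split; first by rewrite boxE; exact: finite_fset.
rewrite boxE set_fsetK card_imfset => [|g g' /rowP gg']; last first.
  apply/ffunP => j; apply/val_inj; have := gg' j; rewrite !mxE => /addrI.
  by move=> [].
rewrite /= undup_id ?enum_uniq// -cardE card_dep_ffun.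
rewrite foldrE big_image/=; apply: eq_bigr => j _; exact: card_ord.
Qed.

Lemma Lambda_box n : Lambda n = box (fun=> - n%:Z) (fun=> n.*2.+1) :> set 'rV[int]_d.
Proof. by apply/seteqP; split => k h j; have := h j; lia. Qed.

Lemma mem_Lambda n (k : 'rV[int]_d) :
  (forall j, `|k ord0 j| <= n)%N -> Lambda n k.
Proof. by move=> kn j; have := kn j; lia. Qed.

Lemma Xi_box N (k : 'rV[int]_d) : Xi N k =
  box (fun j => if 0 <= k ord0 j then 1 else - k ord0 j + 1) (fun j => N - `|k ord0 j|)%N.
Proof. by apply/seteqP; split => t h j; have := h j; case: ifP; lia. Qed.

Lemma Lambda_finite n : finite_set (Lambda n : set 'rV[int]_d).
Proof. by rewrite Lambda_box; case: (box_card (fun=> - n%:Z) (fun=> n.*2.+1)). Qed.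

Lemma Xi_finite N (k : 'rV[int]_d) : finite_set (Xi N k).
Proof. by rewrite Xi_box; apply: (box_card _ _).1. Qed.

Lemma card_Lambda n : #|` fset_set (Lambda n : set 'rV[int]_d)| = (n.*2.+1 ^ d)%N.
Proof.
rewrite Lambda_box (box_card _ _).2.
by rewrite prod_nat_const card_ord.
Qed.

Lemma card_Xi N (k : 'rV[int]_d) :
  #|` fset_set (Xi N k)| = (\prod_j (N - `|k ord0 j|))%N.
Proof. by rewrite Xi_box (box_card _ _).2. Qed.

Variable R : realType.

(** The factor by which the biased estimate shrinks a covariance: its mean at lag [k] is
    [overlap N k] times the autocovariance. *)
Definition overlap (N : nat) (k : 'rV[int]_d) : R :=
  (N%:R ^+ d)^-1 * #|` fset_set (Xi N k)|%:R.

(** The Weierstrass product inequality. *)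
Lemma one_sub_prod_le (I : Type) (s : seq I) (v : I -> R) :
  (forall i, 0 <= v i <= 1) ->
  0 <= \prod_(i <- s) v i <= 1 /\
  1 - \prod_(i <- s) v i <= \sum_(i <- s) (1 - v i).
Proof.
move=> v01; elim: s => [|i s [/andP[IH0 IH1] IH]]; first by rewrite !big_nil; split; [lra|lra].
rewrite !big_cons; have /andP[v0 v1] := v01 i.
by split; [apply/andP; split|]; nra.
Qed.

Lemma overlap_prod N (k : 'rV[int]_d) : (0 < N)%N ->
  overlap N k = \prod_j ((N - `|k ord0 j|)%N%:R / N%:R).
Proof.
move=> N0; rewrite /overlap card_Xi natr_prod prodf_div prodr_const card_ord.
by rewrite mulrC.
Qed.

Lemma overlap_factor N (k : 'rV[int]_d) j : (0 < N)%N ->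
  0 <= ((N - `|k ord0 j|)%N%:R / N%:R : R) <= 1.
Proof.
move=> N0; rewrite divr_ge0//= ler_pdivrMr ?ltr0n// mul1r ler_nat; lia.
Qed.

Lemma overlap_01 N (k : 'rV[int]_d) : (0 < N)%N -> 0 <= overlap N k <= 1.
Proof.
move=> N0; rewrite overlap_prod//.
by have [] := one_sub_prod_le (index_enum 'I_d) (fun j => overlap_factor k j N0).
Qed.

Lemma one_sub_overlap_le N (k : 'rV[int]_d) b : (0 < N)%N -> (forall j, `|k ord0 j| <= b)%N ->
  1 - overlap N k <= (d * b)%:R / N%:R.
Proof.
move=> N0 kb; rewrite overlap_prod//.
have [_ h] := one_sub_prod_le (index_enum 'I_d) (fun j => overlap_factor k j N0).
apply: (le_trans h); apply: (@le_trans _ _ (\sum_(j < d) b%:R / N%:R)).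
  apply: ler_sum => j _; rewrite -{1}(@divff _ N%:R) ?pnatr_eq0 -?lt0n//.
  rewrite -mulrBl ler_pM2r ?invr_gt0 ?ltr0n// lerBlDr -natrD ler_nat.
  by have := kb j; lia.
by rewrite sumr_const card_ord -[leLHS]mulr_natl natrM mulrA.
Qed.

Lemma card_Xi_le N (k : 'rV[int]_d) : #|` fset_set (Xi N k)|%:R <= N%:R ^+ d :> R.
Proof.
rewrite card_Xi -natrX ler_nat; apply: (@leq_trans (\prod_(j < d) N)%N).
  by apply: leq_prod => j _; lia.
by rewrite prod_nat_const card_ord.
Qed.

End Boxes.

Section Bias.
Variables (R : realType) (I : choiceType).
Import Normc.

(** Dominated convergence by hand. With [F] a large set containing [L], the error splits into the
    remainder beyond [F], the terms of [F] outside [L], and the terms of [L] weighted by [1 - c].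
    The first is arbitrarily small, the second is a tail off [K0], and the third is a tail plus the
    explicit sum over [K0], the only place where [c] has to be close to 1. *)
Lemma weighted_sum_bias (a : I -> R) (z : I -> R[i]) (l : R[i]) (K0 : {fset I}) (eps : R) :
  (forall i, normc (z i) <= a i) ->
  (forall delta, 0 < delta ->
    eventually_fset (fun F => normc (l - \sum_(i <- F) z i) <= delta)) ->
  (forall F : {fset I}, (forall i, i \in F -> i \notin K0) -> \sum_(i <- F) a i <= eps) ->
  forall (L : {fset I}) (c : I -> R), (K0 `<=` L)%fset -> (forall i, 0 <= c i <= 1) ->
  normc (l - \sum_(i <- L) real_complex R (c i) * z i) <=
    eps + eps + \sum_(i <- K0) (1 - c i) * a i.
Proof.
move=> za lz aK0 L c K0L c01.
have a0 i : 0 <= a i by rewrite (le_trans _ (za i))// normc_ge0.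
apply/ler_addgt0Pl => delta delta0.
have [F0 HF0] := lz _ delta0; pose F := (F0 `|` L)%fset.
have HF := HF0 F (fsubsetUl _ _).
have FL : [fset i in F | i \in L]%fset = L.
  by apply/fsetP => i; rewrite !inE/=; case: (i \in L); rewrite ?orbT ?andbF.
have split_sum : l - \sum_(i <- L) real_complex R (c i) * z i =
    (l - \sum_(i <- F) z i) + (\sum_(i <- [fset i in F | i \notin L]%fset) z i +
      \sum_(i <- L) real_complex R (1 - c i) * z i).
  rewrite [in RHS](big_fsetID _ (mem L) F)/= FL.
  under [X in _ = _ + (_ + X)]eq_bigr do rewrite rmorphB rmorph1 mulrBl mul1r.
  by rewrite sumrB; ring.
rewrite split_sum; apply: (le_trans (le_normcD _ _)); apply: lerD => //.
apply: (le_trans (le_normcD _ _)); rewrite -addrA; apply: lerD.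
  apply: (le_trans (normc_sum_le _ _)).
  apply: (@le_trans _ _ (\sum_(i <- [fset i in F | i \notin L]%fset) a i)).
    exact: ler_sum.
  apply: aK0 => i; rewrite !inE/= => /andP[_]; apply: contra; exact: (fsubsetP K0L).
apply: (le_trans (normc_sum_le _ _)).
apply: (@le_trans _ _ (\sum_(i <- L) (1 - c i) * a i)).
  apply: ler_sum => i _; rewrite normcM normc_real.
  have /andP[c0 c1] := c01 i.
  by rewrite ger0_norm ?subr_ge0// ler_wpM2l ?subr_ge0.
rewrite (big_fsetID _ (mem K0))/= [leLHS]addrC.
have -> : [fset i in L | i \in K0]%fset = K0.
  by apply/fsetP => i; rewrite !inE/= andbC; case: (boolP (i \in K0)) => //= /(fsubsetP K0L).
rewrite lerD2r.
apply: (@le_trans _ _ (\sum_(i <- [fset i in L | i \notin K0]%fset) a i)).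
  apply: ler_sum => i _; have /andP[c0 c1] := c01 i.
  by rewrite ler_piMl// gerBl.
by apply: aK0 => i; rewrite !inE/= => /andP[].
Qed.

End Bias.

(** The integral of a nonnegative function is a supremum over the simple functions below it, which
    is monotone at once. This lets the squared Frobenius error be dominated directly. *)
Lemma ge0_le_integral_nonmeas (d : measure_display) (T : measurableType d) (R : realType)
    (mu : {measure set T -> \bar R}) (f g : T -> \bar R) :
  (forall x, 0 <= f x)%E -> (forall x, f x <= g x)%E ->
  (\int[mu]_x f x <= \int[mu]_x g x)%E.
Proof.
move=> f0 fg; have g0 x : (0 <= g x)%E := le_trans (f0 x) (fg x).
rewrite !ge0_integralTE//; apply: le_ereal_sup => _ [h hf <-].
by exists h => // x; exact: le_trans (hf x) (fg x).
Qed.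

(** * Mean-square error at a fixed frequency *)

Section Periodogram.
Context (disp : measure_display) (T : measurableType disp) (R : realType).
Variable P : probability T R.
Local Notation L1 X := (P.-integrable [set: T] (EFin \o X)).
Local Notation mean X := (Rintegral P [set: T] X).
Variables (d m : nat) (y : 'rV[int]_d -> T -> 'cV[R]_m).
Import Normc.

(** The fluctuation of the estimate around its own mean, with the bias left out. *)
Definition cov_error (N : nat) (k : 'rV[int]_d) (i j : 'I_m) (w : T) : R :=
  overlap R N k * autocov P y k i j - biased_cov y N k w i j.

Lemma cov_errorE N k i j w : cov_error N k i j w = - (N%:R ^+ d)^-1 *
  \sum_(t <- fset_set (Xi N k)) (lag_product y t k w i j - autocov P y k i j).
Proof.
have -> : cov_error N k i j w = overlap R N k * autocov P y k i j -
    (N%:R ^+ d)^-1 * \sum_(t <- fset_set (Xi N k)) lag_product y t k w i j.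
  rewrite /cov_error /biased_cov fsbig_finite/=; last exact: Xi_finite.
  by rewrite [X in _ - X]mxE summxE.
rewrite sumrB big_const_seq count_predT iter_addr_0 /overlap.
rewrite -(mulr_natl (autocov P y k i j)); set c := (N%:R ^+ d)^-1; ring.
Qed.

Lemma cov_error_variance (C : R) N : 0 <= C -> (0 < N)%N ->
  (forall (Xi : {fset 'rV[int]_d}) k i j,
    L1 (fun w => (\sum_(t <- Xi) (lag_product y t k w i j - autocov P y k i j)) ^+ 2) /\
    mean (fun w => (\sum_(t <- Xi) (lag_product y t k w i j - autocov P y k i j)) ^+ 2)
      <= C * #|` Xi|%:R) ->
  forall k i j, L1 (fun w => cov_error N k i j w ^+ 2) /\
    mean (fun w => cov_error N k i j w ^+ 2) <= C / N%:R ^+ d.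
Proof.
move=> C0 N0 HC k i j; have [iS Sle] := HC (fset_set (Xi N k)) k i j.
rewrite (_ : (fun w => cov_error N k i j w ^+ 2) = (fun w => (N%:R ^+ d)^-1 ^+ 2 *
    (\sum_(t <- fset_set (Xi N k)) (lag_product y t k w i j - autocov P y k i j)) ^+ 2));
    last by apply/funext => w; rewrite cov_errorE exprMn sqrrN.
split; first exact: integrableZr.
rewrite RintegralZl//.
have Nd0 : 0 < N%:R ^+ d :> R by rewrite exprn_gt0// ltr0n.
apply: (@le_trans _ _ ((N%:R ^+ d)^-1 ^+ 2 * (C * N%:R ^+ d))).
  rewrite ler_wpM2l ?sqr_ge0// (le_trans Sle)// ler_wpM2l//; exact: card_Xi_le.
by rewrite le_eqVlt; apply/orP; left; apply/eqP; field; rewrite gt_eqF.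
Qed.

Lemma periodogram_entry n N theta w i j :
  truncated_periodogram y n N theta w i j =
  \sum_(k <- fset_set (Lambda n : set 'rV[int]_d))
    fourier_term (biased_cov y N k w) k theta i j.
Proof.
by rewrite /truncated_periodogram fsbig_finite/= ?summxE//; exact: Lambda_finite.
Qed.

(** [D] bounds the bias. In the fluctuation the exponentials have modulus one, so [theta]
    disappears; Cauchy-Schwarz with unit weights then costs a factor [#|Lam|]. *)
Lemma periodogram_error_entry n N theta w i j (l : R[i]) (D : R) :
  let Lam := fset_set (Lambda n : set 'rV[int]_d) in
  normc (l - \sum_(k <- Lam) real_complex R (overlap R N k) *
     fourier_term (autocov P y k) k theta i j) <= D ->
  normc (l - truncated_periodogram y n N theta w i j) ^+ 2 <=
    2 * D ^+ 2 + 2 * (#|` Lam|%:R * \sum_(k <- Lam) cov_error N k i j w ^+ 2).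
Proof.
move=> Lam lD.
have D0 : 0 <= D := le_trans (normc_ge0 _) lD.
pose S := \sum_(k <- Lam) `|cov_error N k i j w|.
have S0 : 0 <= S by exact: sumr_ge0.
have le1 : normc (l - truncated_periodogram y n N theta w i j) <= D + S.
  rewrite periodogram_entry -/Lam.
  have -> : l - \sum_(k <- Lam) fourier_term (biased_cov y N k w) k theta i j =
     (l - \sum_(k <- Lam) real_complex R (overlap R N k) *
       fourier_term (autocov P y k) k theta i j) +
     \sum_(k <- Lam) cexpi (- pairing k theta) * real_complex R (cov_error N k i j w).
    rewrite -[in RHS]addrA; congr (_ + _); rewrite -!sumrN -big_split/=.
    apply: eq_bigr => k _; rewrite !fourier_term_entry /cov_error.
    by move: (overlap R N k) => o; rewrite rmorphB rmorphM/=; ring.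
  apply: (le_trans (le_normcD _ _)); apply: lerD => //.
  apply: (le_trans (normc_sum_le _ _)); apply: ler_sum => k _.
  by rewrite normcM normc_cexpi mul1r normc_real.
have S2 : S ^+ 2 <= #|` Lam|%:R * \sum_(k <- Lam) cov_error N k i j w ^+ 2.
  have := sqr_sum_weighted_le Lam (fun=> 1) (fun k => `|cov_error N k i j w|).
  under eq_bigr do rewrite mul1r.
  rewrite normr1 big_const_seq count_predT iter_addr_0.
  under [X in _ <= _ * X -> _]eq_bigr do rewrite mul1r real_normK ?num_real//.
  by [].
apply: (@le_trans _ _ ((D + S) ^+ 2)).
  by rewrite lerXn2r ?nnegrE ?normc_ge0 ?addr_ge0.
by have := sqr_ge0 (D - S); nra.
Qed.

Lemma cfrobenius_sqr (A : 'M[R[i]]_m) :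
  cfrobenius A ^+ 2 = \sum_i \sum_j normc (A i j) ^+ 2.
Proof.
by rewrite sqr_sqrtr// sumr_ge0// => i _; rewrite sumr_ge0// => j _; exact: sqr_ge0.
Qed.

(** One factor [(2n+1)^d] comes from Cauchy-Schwarz and one from the number of variances summed;
    [m ^+ 2] counts the entries. The bound does not contain [theta]. *)
Lemma periodogram_error_mean (C D : R) n N theta (L : 'M[R[i]]_m) : 0 <= C -> (0 < N)%N ->
  (forall k i j, L1 (fun w => cov_error N k i j w ^+ 2) /\
    mean (fun w => cov_error N k i j w ^+ 2) <= C / N%:R ^+ d) ->
  (forall i j, normc (L i j - \sum_(k <- fset_set (Lambda n : set 'rV[int]_d))
     real_complex R (overlap R N k) *
     fourier_term (autocov P y k) k theta i j) <= D) ->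
  ('E_P[fun w => (cfrobenius (L - truncated_periodogram y n N theta w) ^+ 2)%R] <=
   (m%:R ^+ 2 * (2 * D ^+ 2 + 2 * (C * (((n.*2.+1) ^ d)%N%:R ^+ 2 / N%:R ^+ d))))%:E)%E.
Proof.
move=> C0 N0 HC HD; set Lam := fset_set _ in HD.
have cardL : #|` Lam| = (n.*2.+1 ^ d)%N by exact: card_Lambda.
pose g i j w := 2 * D ^+ 2 + 2 * (#|` Lam|%:R * \sum_(k <- Lam) cov_error N k i j w ^+ 2).
have iS i j : L1 (fun w => \sum_(k <- Lam) cov_error N k i j w ^+ 2).
  by apply: integrable_sumr => k; case: (HC k i j).
have iS1 i j := integrableZr #|` Lam|%:R (iS i j).
have iS2 i j := integrableZr 2 (iS1 i j).
have ig i j : L1 (g i j) by apply: integrableDr => //; exact: integrable_cstr.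
have iG : L1 (fun w => \sum_i \sum_j g i j w).
  by apply: integrable_sumr => i; exact: integrable_sumr.
rewrite expectation.unlock.
apply: (@le_trans _ _ (\int[P]_w (\sum_i \sum_j g i j w)%:E)%E).
  apply: ge0_le_integral_nonmeas => w; rewrite lee_fin ?sqr_ge0//.
  rewrite cfrobenius_sqr; apply: ler_sum => i _; apply: ler_sum => j _.
  rewrite !mxE; apply: periodogram_error_entry; exact: HD.
rewrite -EFin_mean// lee_fin mean_sum => [|i]; last exact: integrable_sumr.
have gle i j : mean (g i j) <=
    2 * D ^+ 2 + 2 * (C * (((n.*2.+1) ^ d)%N%:R ^+ 2 / N%:R ^+ d)).
  rewrite /g (RintegralD measurableT (integrable_cstr _ _) (iS2 i j)) mean_cst.
  rewrite lerD2l (RintegralZl _ measurableT (iS1 i j)) (RintegralZl _ measurableT (iS i j)).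
  rewrite ler_pM2l// mean_sum; last by move=> k; case: (HC k i j).
  apply: (@le_trans _ _ (#|` Lam|%:R * \sum_(k <- Lam) (C / N%:R ^+ d))).
    by rewrite ler_wpM2l// ler_sum// => k _; case: (HC k i j).
  rewrite big_const_seq count_predT iter_addr_0 -[X in _ * X <= _]mulr_natr.
  rewrite -cardL le_eqVlt; apply/orP; left; apply/eqP.
  by rewrite -/(#|` Lam|); ring.
apply: (@le_trans _ _ (\sum_(i < m) \sum_(j < m)
    (2 * D ^+ 2 + 2 * (C * (((n.*2.+1) ^ d)%N%:R ^+ 2 / N%:R ^+ d))))).
  apply: ler_sum => i _; rewrite mean_sum//; exact: ler_sum.
rewrite !sumr_const !card_ord -mulrnA -[leLHS]mulr_natl natrM -expr2.
by rewrite lexx.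
Qed.

End Periodogram.

(** For [n >= 1], [2n + 1 <= 3n] bounds the ratio by the [d]-th power of [9 n^2 / N]; as this number
    is at most 1 and [d > 0], the power only decreases it. *)
Lemma lag_count_ratio (R : realType) (d n N : nat) (eta : R) : (0 < d)%N -> (0 < n)%N ->
  (0 < N)%N -> eta <= 1 -> 9 * (n%:R ^+ 2 / N%:R) <= eta ->
  ((n.*2.+1) ^ d)%N%:R ^+ 2 / N%:R ^+ d <= eta.
Proof.
move=> d0 n0 N0 eta1 hn.
have q0 : 0 <= 9 * (n%:R ^+ 2 / N%:R) :> R by rewrite mulr_ge0// divr_ge0// sqr_ge0.
have q1 := le_trans hn eta1.
apply: le_trans hn; apply: (@le_trans _ _ ((9 * (n%:R ^+ 2 / N%:R)) ^+ d)); last first.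
  by rewrite -[leRHS]expr1 ler_wiXn2l.
rewrite mulrA exprMn exprVn ler_wpM2r ?invr_ge0 ?exprn_ge0//.
rewrite natrX exprAC lerXn2r ?nnegrE ?sqr_ge0 ?mulr_ge0 ?sqr_ge0//.
rewrite (_ : 9 * n%:R ^+ 2 = (3 * n%:R) ^+ 2 :> R); last by ring.
by rewrite lerXn2r ?nnegrE// -natrM ler_nat; lia.
Qed.

(** * Combining bias and fluctuation uniformly in the frequency *)

Theorem theorem3
  (R : realType) (disp : measure_display) (T : measurableType disp)
  (P : probability T R) (d m p : nat)
  (hd : (0 < d)%N) (hm : (0 < m)%N) (hp : (0 < p)%N)
  (M : 'rV[int]_d -> 'M[R]_(m, p))
  (hM : (\esum_(s in [set: 'rV[int]_d]) (frobenius (M s))%:E < +oo)%E)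
  (e : 'rV[int]_d -> T -> 'cV[R]_p) (he : white_gaussian_noise P e)
  (y : 'rV[int]_d -> T -> 'cV[R]_m) (hy : filtered_noise P M e y)
  (f : nat -> nat) (hf : f N @[N --> \oo] --> \oo)
  (hf2 : (f N)%:R ^+ 2 / N%:R @[N --> \oo] --> (0 : R)) :
  (forall t k : 'rV[int]_d, lag_cov P y t k = autocov P y k) /\
  (forall eps : R, 0 < eps -> \forall N \near \oo,
     forall theta : 'rV[R]_d, torus theta ->
       ('E_P[fun w => (cfrobenius (spectral_density P y theta
                - truncated_periodogram y (f N) N theta w) ^+ 2)%R]
        < eps%:E)%E).
Proof.
split; first by move=> t k; exact: (lag_cov_stationary he hy).
move=> eps eps0.
have [B B0 HB] := sum_autocov_le hM he hy.
have [C C0 HC] := lag_sum_variance hM he hy.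
(* One summable majorant for all entries, so that the thresholds depend neither on the entry nor on
   the frequency. *)
pose a k : R := \sum_i \sum_j `|autocov P y k i j|.
have a_ge k i j : `|autocov P y k i j| <= a k.
  rewrite /a (bigD1 i)//= (bigD1 j)//= -addrA lerDl addr_ge0 ?sumr_ge0// => l _.
  by rewrite sumr_ge0.
have a0 k : 0 <= a k by rewrite sumr_ge0// => i _; rewrite sumr_ge0.
pose Q : R := m%:R ^+ 2.
have Q1 : 0 < Q by rewrite exprn_gt0// ltr0n.
have aB (F : {fset 'rV[int]_d}) : \sum_(k <- F) a k <= Q * B.
  rewrite /a exchange_big/=.
  apply: (@le_trans _ _ (\sum_(i < m) \sum_(j < m) B)).
    by apply: ler_sum => i _; rewrite exchange_big/=; apply: ler_sum => j _.
  by rewrite !sumr_const !card_ord -mulrnA -[leLHS]mulr_natl natrM -expr2.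
(* Bias tolerance: as [D <= 1], the share [Q * (2 * D^2)] is at most [2 Q D <= eps / 18]. *)
pose D : R := Num.min 1 (eps / (36 * Q)).
have D0 : 0 < D by rewrite lt_min ltr01 divr_gt0// mulr_gt0.
have D1 : D <= 1 by rewrite ge_min lexx.
have Deps : 36 * (Q * D) <= eps.
  rewrite mulrA mulrC -ler_pdivlMr; last by rewrite mulr_gt0.
  by rewrite ge_min lexx orbT.
(* Fluctuation tolerance: its share is at most [2 Q (C + 1) eta <= eps / 4]. [C + 1] keeps the
   divisor positive when [C = 0]. *)
pose eta : R := Num.min 1 (eps / (8 * (Q * (C + 1)))).
have QC : 0 < Q * (C + 1) by rewrite mulr_gt0// ltr_wpDl.
have eta0 : 0 < eta by rewrite lt_min ltr01 divr_gt0// mulr_gt0.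
have eta1 : eta <= 1 by rewrite ge_min lexx.
have etaeps : 8 * (Q * (C + 1)) * eta <= eps.
  rewrite mulrC -ler_pdivlMr; last by rewrite mulr_gt0.
  by rewrite ge_min lexx orbT.
have D3 : 0 < D / 3 by rewrite divr_gt0.
have [K0 HK0] := sum_tail_small a0 aB D3.
pose b := (\sum_(k <- K0) \sum_j `|k ord0 j|)%N.
have b_ge k j : k \in K0 -> (`|k ord0 j| <= b)%N.
  move=> kK; rewrite /b (big_fsetD1 k)//= (bigD1 j)//=.
  by rewrite -addnA leq_addr.
(* [f N >= b] puts [K0] inside [Lambda (f N)]; the successor also gives [f N > 0], needed for
   [2n + 1 <= 3n]. *)
have near_f : \forall N \near \oo, (b.+1 <= f N)%N.
  exact: (hf [set n | (b.+1 <= n)%N] (nbhs_infty_ge b.+1)).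
have near_f2 : \forall N \near \oo, `|(f N)%:R ^+ 2 / N%:R| <= eta / 9.
  by apply: (cvgr0_norm_le _ hf2); rewrite divr_gt0.
(* [N] is fixed before [theta], and none of the conditions imposed on it mentions [theta]: this is
   the uniformity. *)
near=> N => theta _.
have N0 : (0 < N)%N by near: N; exact: nbhs_infty_gt.
have fNb : (b.+1 <= f N)%N by near: N.
have fN2 : 9 * ((f N)%:R ^+ 2 / N%:R) <= eta.
  have : `|(f N)%:R ^+ 2 / N%:R| <= eta / 9 by near: N.
  by rewrite ger0_norm ?divr_ge0 ?sqr_ge0//; lra.
have Nbig : (d * b)%:R / N%:R * (Q * B) <= D / 3.
  have : (d * b)%:R * (Q * B) / (D / 3) <= N%:R by near: N; exact: nbhs_infty_ger.
  rewrite ler_pdivrMr// => h.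
  by rewrite mulrAC ler_pdivrMr ?ltr0n// [leRHS]mulrC.
pose z (i j : 'I_m) k := fourier_term (autocov P y k) k theta i j.
have za i j k : Normc.normc (z i j k) <= a k by rewrite normc_fourier_term.
have HL i j := complex_sum_limit (za i j) aB.
(* The entrywise limits exist by absolute summability; they are chosen here and then identified with
   the spectral density. *)
pose L : 'M[R[i]]_m := \matrix_(i, j) projT1 (cid (HL i j)).
have HLE i j delta : 0 < delta -> eventually_fset (fun F =>
    Normc.normc (L i j - \sum_(k <- F) z i j k) <= delta).
  by rewrite mxE => delta0; case: (cid (HL i j)) => l /= /(_ _ delta0).
have -> : spectral_density P y theta = L by apply: matrix_sum_eq.
have HD i j : Normc.normc (L i j - \sum_(k <- fset_set (Lambda (f N) : set 'rV[int]_d))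
    real_complex R (overlap R N k) * z i j k) <= D.
  have K0L : (K0 `<=` fset_set (Lambda (f N) : set 'rV[int]_d))%fset.
    apply/fsubsetP => k kK0; rewrite in_fset_set; last exact: Lambda_finite.
    rewrite inE; apply: mem_Lambda => l.
    exact: leq_trans (b_ge k l kK0) (ltnW fNb).
  have := weighted_sum_bias (za i j) (HLE i j) HK0 K0L (fun k => overlap_01 R k N0).
  move=> /le_trans; apply.
  (* Two thirds pay for the two tails off [K0], the last for the missing overlap on [K0]. *)
  rewrite [leRHS](_ : D = D / 3 + D / 3 + D / 3); last by field.
  rewrite lerD2l; apply: le_trans Nbig.
  apply: (@le_trans _ _ (\sum_(k <- K0) (d * b)%:R / N%:R * a k)).
    rewrite [leLHS]big_seq [leRHS]big_seq; apply: ler_sum => k kK0.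
    by rewrite ler_wpM2r// one_sub_overlap_le// => l; exact: b_ge.
  by rewrite -mulr_sumr ler_wpM2l// divr_ge0.
have := periodogram_error_mean C0 N0 (cov_error_variance C0 N0 HC) HD.
move=> /le_lt_trans; apply; rewrite lte_fin -/Q.
have hq := lag_count_ratio hd (leq_ltn_trans (leq0n b) fNb) N0 eta1 fN2.
set q := _ / _ in hq *.
have h1 : Q * (2 * D ^+ 2) <= Q * (2 * D) by rewrite ler_pM2l// ler_pM2l// expr2 ler_piMl// ltW.
have h2 : Q * (2 * (C * q)) <= 2 * (Q * (C + 1) * eta).
  have : Q * C * q <= Q * (C + 1) * eta.
    apply: (@le_trans _ _ (Q * C * eta)).
      by rewrite ler_wpM2l// mulr_ge0// ltW.
    by rewrite ler_wpM2r ?(ltW eta0)// ler_pM2l// lerDl.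
  by lra.
rewrite mulrDr; lra.
Unshelve. all: by end_near.
Qed.
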